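(* Let $K$ be a field, let $\mathcal{L}$ be a set of $m$ distinct lines and $\mathcal{P}$ a set of $n$ distinct points in $K^3$. Assume that every line of $\mathcal{L}$ contains at least $\sqrt{m}$ points of $\mathcal{P}$ and that no plane contains more than $\sqrt{m}$ of the lines of $\mathcal{L}$. (1) If $K$ has characteristic $0$ then $n\geq \tfrac{1}{50}\cdot m^{3/2}$. (2) If $K$ has positive characteristic and $m\geq 10^4$ then $n\geq \tfrac{1}{20}\cdot m^{5/4}$.
   Context: Lines and planes are affine lines and planes in $K^3$ (defined over $K$). *)

(* Defs.v *)
From HB Require Import structures.
From mathcomp Require Import all_boot all_order all_algebra.
From mathcomp Require Import finmap boolp classical_sets reals exp.
Set Implicit Arguments.
Unset Strict Implicit.
Unset Printing Implicit Defensive.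

Import Order.TTheory GRing.Theory Num.Theory.
Local Open Scope classical_set_scope.
Local Open Scope ring_scope.

(* An affine k-flat over K: the translate p + V of a k-dimensional linear subspace
   V of K^3, as a set of points, so equality of flats is equality of point sets. *)
Definition is_flat (K : fieldType) (k : nat) (A : set 'rV[K]_3) : Prop :=
  exists (p : 'rV[K]_3) (V : {vspace 'rV[K]_3}),
    \dim V = k /\ A = [set x | x - p \in V].

Definition is_line (K : fieldType) (l : set 'rV[K]_3) : Prop := is_flat 1 l.

Definition is_plane (K : fieldType) (H : set 'rV[K]_3) : Prop := is_flat 2 H.

Definition points_on (K : fieldType) (P : {fset 'rV[K]_3})
    (l : set 'rV[K]_3) : {fset 'rV[K]_3} :=
  [fset x in P | x \in l]%fset.

Definition lines_in (K : fieldType) (L : {fset set 'rV[K]_3})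
    (H : set 'rV[K]_3) : {fset set 'rV[K]_3} :=
  [fset l in L | `[< (l `<=` H)%classic >]]%fset.

(* Main.v *)
(* Put N = sqrt m and suppose that n is too small. A nonzero polynomial F of least degree d
   vanishing on P has d^3 <= 6n < (N/2)^3, so it vanishes on every line of L. Assign every line
   and every point to the first irreducible factor f of F vanishing on it, and let f, of degree a,
   receive m_f lines and n_f points. Let e be the least degree of a polynomial g vanishing
   on these n_f points and not divisible by f; a dimension count gives
   6 n_f >= e^3 - (e - a)^3. If e is smaller than the number of assigned points on each line,
   then g vanishes on the m_f lines and Bezout gives m_f <= a e <= N a / 4 + 6 n_f / N.
   Otherwise a N^2 <= 8 n_f. If f = 0 is a plane, then m_f <= N. If it is not, then in
   characteristic 0 a point on three lines is a zero of a polynomial of degree 3a - 4 that is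
   not divisible by f (Guth and Katz: it is flat or singular), so all but 3a^2 lines have
   a fixed proportion of their points on at most two lines. In characteristic p, a point where some partial
   derivative of f is nonzero lies on at most a lines, since these lie in the tangent plane; by
   minimality of F and a Frobenius argument the partial derivatives do not all vanish.
   Summing the bounds for m_f over all f contradicts m = N^2. *)
Require Import Defs.
From HB Require Import structures.
From mathcomp Require Import all_boot all_order all_algebra.
From mathcomp Require Import mpoly.
From mathcomp Require Import ring lra zify.
From mathcomp Require Import finmap boolp classical_sets reals exp.
Set Implicit Arguments.
Unset Strict Implicit.
Unset Printing Implicit Defensive.

Import Order.TTheory GRing.Theory Num.Theory.
Local Open Scope classical_set_scope.
Local Open Scope ring_scope.

(** * Factoriality of polynomial rings *)

(** [K] may be finite or imperfect, which shapes the tools. When all partial derivatives of [f]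
    vanish, [f] need not be a p-th power over an imperfect field, so its degree is lowered by
    comparing ranks of evaluation matrices and not by taking a root.

    Each factor gets a bound N/4 a + be q, a shape that adds up: the degrees a sum to d < N/2 and
    the points q to n, so the total is at most N^2/8 + be n. The constant 50 exceeds 48 = 6 * 8,
    which is what d < N/2 asks for. Flatness is confined to characteristic 0 because a tangent line
    meeting the surface to order k contributes a factor k (k - 1), which may vanish modulo p. There
    be = 16/N, whence n of order N^3. In characteristic p the tangent-plane bound a replaces 2 as
    the number of lines through a point; this gives be = 8/N + 16 n/N^3, and its quadratic
    contribution in n is the source of the exponent 5/4. *)

Definition divides (R : comNzRingType) (a b : R) : Prop := exists c, b = c * a.

Definition irred_elt (R : idomainType) (a : R) : Prop :=
  [/\ a != 0, a \isn't a GRing.unit &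
      forall b c, a = b * c -> b \is a GRing.unit \/ c \is a GRing.unit].

Definition prime_elt (R : idomainType) (a : R) : Prop :=
  [/\ a != 0, a \isn't a GRing.unit &
      forall b c, divides a (b * c) -> divides a b \/ divides a c].

(* Factoriality: [nu] counts prime factors, so that dividing out primes terminates. *)
Definition factorial_domain (R : idomainType) : Prop :=
  exists nu : R -> nat,
  [/\ forall a b : R, a != 0 -> b != 0 -> nu (a * b) = (nu a + nu b)%N,
      forall a : R, a != 0 -> nu a = 0%N -> a \is a GRing.unit &
      forall a : R, a != 0 -> a \isn't a GRing.unit ->
        exists2 p, prime_elt p & divides p a].

(** A nonunit has a prime divisor [p]; irreducibility makes the cofactor a unit, so [a] is an
    associate of [p]. *)
Lemma irred_prime (R : idomainType) (a : R) :
  factorial_domain R -> irred_elt a -> prime_elt a.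
Proof.
move=> [nu [_ _ hp]] [a0 aU airr].
have [p [p0 pU pp] [c ac]] := hp a a0 aU.
split=> // b d ab; have [cU|pU'] := airr _ _ ac; last by rewrite pU' in pU.
have dpa x : divides p x -> divides a x.
  by move=> [e ->]; exists (e * c^-1); rewrite ac mulrA divrK.
have : divides p (b * d).
  by case: ab => e ->; exists (e * c); rewrite ac mulrA.
by case/pp => /dpa; [left|right].
Qed.

Section GaussLemma.
Variable R : idomainType.
Implicit Types (p c : R) (f g h k r : {poly R}).

Definition primitive f := forall p, prime_elt p -> ~ divides p%:P f.

Lemma dividesD (A : comNzRingType) (a b c : A) :
  divides a b -> divides a c -> divides a (b + c).
Proof. by move=> [x ->] [y ->]; exists (x + y); rewrite mulrDl. Qed.

Lemma dividesN (A : comNzRingType) (a b : A) : divides a b -> divides a (- b).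
Proof. by move=> [x ->]; exists (- x); rewrite mulNr. Qed.

Lemma dividesMl (A : comNzRingType) (a b c : A) :
  divides a b -> divides a (c * b).
Proof. by move=> [x ->]; exists (c * x); rewrite mulrA. Qed.

Lemma divides_trans (A : comNzRingType) (a b c : A) :
  divides a b -> divides b c -> divides a c.
Proof. by move=> [x ->] [y ->]; exists (y * x); rewrite mulrA. Qed.

Lemma divides_monom p c (n : nat) : divides p c -> divides p%:P (c *: 'X^n).
Proof.
by move=> [e ->]; exists (e *: 'X^n); rewrite [RHS]mulrC mul_polyC scalerA mulrC.
Qed.

Lemma size_strip_lead f : f != 0 ->
  (size (f - lead_coef f *: 'X^((size f).-1))%R < size f)%N.
Proof.
move=> f0; have sf : (0 < size f)%N by rewrite size_poly_gt0.
rewrite -[X in (_ < X)%N](prednK sf) ltnS; apply/leq_sizeP => j hj.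
rewrite coefB coefZ coefXn; case: eqP => [->|/eqP nj].
  by rewrite mulr1 /lead_coef subrr.
by rewrite mulr0 subr0 nth_default // -(prednK sf) ltn_neqAle eq_sym nj.
Qed.

(** Gauss's lemma: [p] divides the product of the leading coefficients, hence one of them, and that
    leading term can be stripped without affecting divisibility. *)
Lemma prime_polyC p : prime_elt p -> prime_elt (p%:P : {poly R}).
Proof.
move=> [p0 pU pp]; split; first by rewrite polyC_eq0.
  by rewrite poly_unitE size_polyC p0 coefC eqxx.
move=> f g; have [n] := ubnP (size f + size g); elim: n f g => // n IH f g.
rewrite ltnS => hn pfg.
have [->|f0] := eqVneq f 0; first by left; exists 0; rewrite mul0r.
have [->|g0] := eqVneq g 0; first by right; exists 0; rewrite mul0r.
have : divides p (lead_coef f * lead_coef g).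
  case: pfg => e /(congr1 lead_coef); rewrite !lead_coefM lead_coefC => ->.
  by exists (lead_coef e).
case/pp => hl.
- set t := lead_coef f *: 'X^((size f).-1).
  have pt : divides p%:P t by apply: divides_monom.
  have [||hf|] := IH (f - t) g; last by right.
  + by rewrite (leq_trans _ hn) // ltn_add2r size_strip_lead.
  + rewrite mulrBl; apply: dividesD => //; apply: dividesN.
    by rewrite mulrC; apply: dividesMl.
  + by left; rewrite -(subrK t f); apply: dividesD.
- set t := lead_coef g *: 'X^((size g).-1).
  have pt : divides p%:P t by apply: divides_monom.
  have [||hf|hg] := IH f (g - t); [| |by left|].
  + by rewrite (leq_trans _ hn) // ltn_add2l size_strip_lead.
  + by rewrite mulrBr; apply: dividesD => //; apply: dividesN; apply: dividesMl.
  + by right; rewrite -(subrK t g); apply: dividesD.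
Qed.

Hypothesis factR : factorial_domain R.

(** Pulling out a constant prime lowers [nu] of the leading coefficient, so the extraction stops. *)
Lemma content_primitive f : f != 0 ->
  exists c g, [/\ c != 0, f = c%:P * g & primitive g].
Proof.
case: factR => nu [nuM nu0 hp].
have [n] := ubnP (nu (lead_coef f)); elim: n f => // n IH f; rewrite ltnS => hn f0.
have [[p [pp [g fg]]]|nprim] := pselect (exists p, prime_elt p /\ divides p%:P f); last first.
  exists 1, f; rewrite oner_eq0 polyC1 mul1r; split=> // p pp df.
  by apply: nprim; exists p.
have g0 : g != 0 by apply: contra_neq f0 => g0; rewrite fg g0 mul0r.
have [p0 pU _] := pp.
have nup : (0 < nu p)%N by rewrite lt0n; apply: contraNneq pU => /nu0 ->.
have [|//|c [h [c0 gh hprim]]] := IH g.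
  apply: leq_trans hn; rewrite fg lead_coefM lead_coefC nuM ?lead_coef_eq0 //.
  by rewrite -addn1 leq_add2l.
exists (p * c), h; split=> //; first by rewrite mulf_neq0.
by rewrite fg gh polyCM mulrC mulrA.
Qed.

(** By Gauss's lemma each prime of [c] divides [k] or [g]; it cannot divide the primitive [g], so
    the primes of [c] are cancelled against [k] one at a time. *)
Lemma primitive_cancel c g h k : c != 0 -> primitive g ->
  c%:P * h = k * g -> divides g h.
Proof.
case: factR => nu [nuM nu0 hp].
have [n] := ubnP (nu c); elim: n c k => // n IH c k; rewrite ltnS => hn c0 gprim e.
have [cU|cU] := boolP (c \is a GRing.unit).
  exists (c^-1%:P * k); rewrite -mulrA -e mulrA -polyCM mulVr //.
  by rewrite polyC1 mul1r.
have [p pp [d cd]] := hp c c0 cU.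
have [p0 pU _] := pp.
have d0 : d != 0 by apply: contra_neq c0 => d0; rewrite cd d0 mul0r.
have nup : (0 < nu p)%N by rewrite lt0n; apply: contraNneq pU => /nu0 ->.
have [_ _ /(_ k g) []] := prime_polyC pp.
- by exists (d%:P * h); rewrite -e cd polyCM -!mulrA [p%:P * _]mulrC.
- move=> [k' kk']; apply: (IH d k') => //.
    by apply: leq_trans hn; rewrite cd nuM // -addn1 leq_add2l.
  apply: (@mulfI _ p%:P); first by rewrite polyC_eq0.
  by rewrite mulrA -polyCM [p * d]mulrC -cd e kk' mulrCA mulrA.
- by move=> /(gprim _ pp).
Qed.

Lemma primitive_divisor f g : primitive f -> divides g f -> primitive g.
Proof. by move=> fprim gf p pp pg; apply: fprim pp _; apply: divides_trans gf. Qed.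

(* A nonzero element of least degree in the ideal (g, h) divides, up to constants, both g
   and h; it is a constant or an associate of g. *)
Lemma minimal_divisor_prime g : primitive g -> (1 < size g)%N ->
  (forall h, divides h g -> (1 < size h)%N -> (size g <= size h)%N) ->
  prime_elt g.
Proof.
move=> gprim sg gmin.
have g0 : g != 0 by rewrite -size_poly_gt0 (ltn_trans _ sg).
split=> //; first by rewrite poly_unitE negb_and (gtn_eqF sg).
move=> h k ghk.
pose inI (r : {poly R}) := exists a b, r = a * g + b * h.
have : exists n, `[< exists2 r, r != 0 /\ inI r & size r = n >].
  exists (size g); apply/asboolP; exists g => //; split=> //.
  by exists 1, 0; rewrite mul0r mul1r addr0.
case/ex_minnP => n /asboolP [r [r0 [a [b rab]]] sr] rmin.
(* Pseudo-division by [r]: the remainder stays in the ideal and is shorter than [r], so it is zero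
   by the choice of [r]. *)
have rdiv s : inI s -> exists2 c, c != 0 & exists q, c%:P * s = q * r.
  move=> [a' [b' sab]]; exists (lead_coef r ^+ Pdiv.Ring.rscalp s r).
    by rewrite expf_neq0 // lead_coef_eq0.
  exists (Pdiv.Ring.rdivp s r).
  have := Pdiv.ComRing.rdivp_eq r s; rewrite -mul_polyC => ->.
  have [->|m0] := eqVneq (Pdiv.Ring.rmodp s r) 0; first by rewrite addr0.
  have : (n <= size (Pdiv.Ring.rmodp s r))%N.
    apply: rmin; apply/asboolP; exists (Pdiv.Ring.rmodp s r) => //; split=> //.
    have := Pdiv.ComRing.rdivp_eq r s; rewrite -mul_polyC.
    set c := (_ ^+ _)%:P; set q := Pdiv.Ring.rdivp s r => e.
    exists (c * a' - q * a), (c * b' - q * b).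
    have -> : Pdiv.Ring.rmodp s r = c * s - q * r by rewrite e addrC addKr.
    by rewrite sab rab; ring.
  by rewrite leqNgt -sr Pdiv.Ring.ltn_rmodp r0.
(* For constant [r], multiplying r = a g + b h by [k] makes r k a multiple of [g], and primitivity
   cancels the constant. *)
have [sr1|sr1] := leqP (size r) 1.
  have re := size1_polyC sr1; case: ghk => e ghk; right.
  apply: (@primitive_cancel r`_0 _ _ (a * k + b * e)) => //.
    by apply: contra_neq r0 => c0; rewrite re c0 polyC0.
  by rewrite -re rab !mulrDl -!mulrA ghk [g * k]mulrC.
have [c1 [r' [c10 rr' r'prim]]] := content_primitive r0.
have sr' : size r' = size r by rewrite rr' mul_polyC size_scale.
have inIr s : inI s -> divides r' s.
  case/rdiv => c c0 [q]; rewrite rr' mulrA => e.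
  exact: (primitive_cancel c0 r'prim e).
have [t gt] : divides r' g by apply: inIr; exists 1, 0; rewrite mul0r mul1r addr0.
have [w hw] : divides r' h by apply: inIr; exists 0, 1; rewrite mul0r mul1r add0r.
(* Minimality of [g] among its nonconstant divisors leaves only a constant cofactor [t]; thus [g]
   divides [h] up to a constant. *)
have /gmin : divides r' g by exists t.
rewrite sr' => /(_ sr1); rewrite -sr' => srg.
have t0 : t != 0 by apply: contra_neq g0 => t0; rewrite gt t0 mul0r.
have r'0 : r' != 0 by apply: contra_neq g0 => t1; rewrite gt t1 mulr0.
have st1 : (size t <= 1)%N.
  have := size_mul t0 r'0; rewrite -gt => sgE.
  have : (0 < size r')%N by rewrite size_poly_gt0.
  move: srg; rewrite sgE => h1 h2.
  have aux x y : ((x + y).-1 <= y -> 0 < y -> x <= 1)%N by lia.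
  exact: aux h1 h2.
have te := size1_polyC st1; left.
apply: (@primitive_cancel t`_0 _ _ w) => //.
  by apply: contra_neq t0 => c0; rewrite te c0 polyC0.
by rewrite -te hw gt mulrCA mulrA.
Qed.

(** The count adds the degree to the prime count of the leading coefficient. A nonunit without
    constant prime divisor is primitive, and its nonconstant divisor of least degree is prime. *)
Lemma factorial_poly : factorial_domain {poly R}.
Proof.
have [nu [nuM nu0 hp]] := factR.
exists (fun f => ((size f).-1 + nu (lead_coef f))%N); split.
- move=> f g f0 g0; rewrite size_mul // lead_coefM nuM ?lead_coef_eq0 //.
  have : (0 < size f)%N by rewrite size_poly_gt0.
  have : (0 < size g)%N by rewrite size_poly_gt0.
  lia.
- move=> f f0 /eqP; rewrite addn_eq0 => /andP[s1 /eqP/nu0 n0].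
  have sf : size f = 1%N.
    have : (0 < size f)%N by rewrite size_poly_gt0.
    move: s1; lia.
  rewrite poly_unitE sf eqxx /=.
  by have := n0; rewrite lead_coef_eq0 => /(_ f0); rewrite lead_coefE sf.
- move=> f f0 fU.
  have [[p [pp pf]]|nprim] := pselect (exists p, prime_elt p /\ divides p%:P f).
    by exists p%:P => //; apply: prime_polyC.
  have fprim : primitive f by move=> p pp pf; apply: nprim; exists p.
  have sf : (1 < size f)%N.
    rewrite ltnNge; apply/negP => sf; have fe := size1_polyC sf.
    move: f0 fU; rewrite fe polyC_eq0 => c0.
    rewrite poly_unitE size_polyC c0 coefC eqxx /= => cU.
    have [p pp [d cd]] := hp _ c0 cU.
    by apply: (fprim p pp); rewrite fe cd; exists d%:P; rewrite polyCM.
  have : exists n, `[< exists2 g, divides g f /\ (1 < size g)%N & size g = n >].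
    exists (size f); apply/asboolP; exists f => //; split=> //.
    by exists 1; rewrite mul1r.
  case/ex_minnP => n /asboolP [g [gf sg] sgn] gmin.
  exists g => //; apply: minimal_divisor_prime => //.
    exact: primitive_divisor gf.
  move=> h hg sh; rewrite sgn; apply: gmin; apply/asboolP; exists h => //.
  by split=> //; apply: divides_trans gf.
Qed.

End GaussLemma.

Lemma factorial_transport (A B : idomainType) (phi : {rmorphism A -> B})
    (psi : {rmorphism B -> A}) :
  cancel phi psi -> cancel psi phi -> factorial_domain B -> factorial_domain A.
Proof.
move=> phiK psiK [nu [nuM nu0 hp]].
have phi_unit a : (phi a \is a GRing.unit) = (a \is a GRing.unit).
  apply/idP/idP => [/(rmorph_unit psi)|/(rmorph_unit phi)//].
  by rewrite phiK.
have phi0 a : (phi a == 0) = (a == 0) by rewrite -(inj_eq (can_inj phiK)) rmorph0.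
have dvE a b : divides a b <-> divides (phi a) (phi b).
  split=> [[c ->]|[c e]]; first by exists (phi c); rewrite rmorphM.
  by exists (psi c); rewrite -[LHS]phiK e rmorphM phiK.
exists (nu \o phi); split=> /=.
- by move=> a b a0 b0; rewrite rmorphM nuM ?phi0.
- by move=> a a0 /nu0; rewrite phi0 phi_unit => /(_ a0).
- move=> a a0 aU; have [||p [p0 pU pp] pa] := hp (phi a); rewrite ?phi0 ?phi_unit //.
  exists (psi p); last by apply/dvE; rewrite psiK.
  split; first by rewrite -phi0 psiK.
    by rewrite -phi_unit psiK.
  by move=> b c /dvE; rewrite psiK rmorphM => /pp [] h; [left|right]; apply/dvE; rewrite psiK.
Qed.

Section MPolyFactorial.
Variable K : fieldType.

Lemma mpoly_rmorph_eq (n : nat) (S : comNzRingType) (f g : {rmorphism {mpoly K[n]} -> S}) :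
  (forall c, f c%:MP = g c%:MP) -> (forall i, f 'X_i = g 'X_i) -> f =1 g.
Proof.
move=> fgC fgX p; rewrite (mpolyE p) !rmorph_sum; apply: eq_bigr => m _.
rewrite -mul_mpolyC !rmorphM fgC; congr (_ * _).
rewrite (mpolyXE_id _ m) !rmorph_prod; apply: eq_bigr => i _.
by rewrite !rmorphXn fgX.
Qed.

Lemma muni_X (n : nat) (i : 'I_n.+1) :
  muni ('X_i : {mpoly K[n.+1]}) =
  match split (cast_ord (esym (addn1 n)) i) with
  | inl j => ('X_j)%:P
  | inr _ => 'X
  end.
Proof. by rewrite /muni mmapX mmap1U. Qed.

Lemma muni_widen (n : nat) (p : {mpoly K[n]}) : muni (mwiden p) = p%:P.
Proof.
pose f : {rmorphism {mpoly K[n]} -> {poly {mpoly K[n]}}} := @muni n K \o @mwiden n K.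
apply: (@mpoly_rmorph_eq n _ f (@polyC _)) => [c|i] /=.
  by rewrite mwidenC muniC.
rewrite mwidenX mnmwiden1 muni_X; case: splitP => [j e|j].
  by congr ('X__)%:P; apply/val_inj => /=; rewrite -e.
by rewrite ord1 /= addn0 => /eqP; rewrite ltn_eqF.
Qed.

(** Inverse of [muni]: the outer variable is evaluated at the last one. It transports factoriality
    from [n] to [n.+1] variables. *)
Definition mhorn (n : nat) : {poly {mpoly K[n]}} -> {mpoly K[n.+1]} :=
  horner_morph (fun p => mulrC 'X_ord_max (mwiden p)).

HB.instance Definition _ n := GRing.RMorphism.on (@mhorn n).

Lemma mhornC (n : nat) (p : {mpoly K[n]}) : mhorn p%:P = mwiden p.
Proof. exact: horner_morphC. Qed.

Lemma mhornX (n : nat) : mhorn 'X = 'X_ord_max :> {mpoly K[n.+1]}.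
Proof. exact: horner_morphX. Qed.

Lemma muni_Xmax (n : nat) : muni ('X_ord_max : {mpoly K[n.+1]}) = 'X.
Proof.
rewrite muni_X; case: splitP => // j /= e.
by have := ltn_ord j; rewrite -e ltnn.
Qed.

Lemma mhornK (n : nat) : cancel (@mhorn n) (@muni n K).
Proof.
elim/poly_ind => [|p c IH]; first by rewrite !rmorph0.
by rewrite rmorphD rmorphM /= mhornX mhornC rmorphD rmorphM /= IH muni_Xmax muni_widen.
Qed.

Lemma muniK (n : nat) : cancel (@muni n K) (@mhorn n).
Proof.
pose f : {rmorphism {mpoly K[n.+1]} -> {mpoly K[n.+1]}} := @mhorn n \o @muni n K.
apply: (@mpoly_rmorph_eq n.+1 _ f idfun) => [c|i] /=.
  by rewrite muniC mhornC mwidenC.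
rewrite muni_X; case: splitP => [j e|j e].
  rewrite mhornC mwidenX mnmwiden1; congr 'X__.
  by apply/val_inj => /=; rewrite -e.
rewrite mhornX; congr 'X__; apply/val_inj => /=.
by move: e; rewrite ord1 /= addn0 => ->.
Qed.

Lemma factorial_mpoly (n : nat) : factorial_domain {mpoly K[n]}.
Proof.
elim: n => [|n IH]; last first.
  exact: factorial_transport (@muniK n) (@mhornK n) (factorial_poly IH).
have U (p : {mpoly K[0]}) : p != 0 -> p \is a GRing.unit.
  rewrite (nvar0_mpolyC p) mpolyC_eq0 => c0.
  by apply: rmorph_unit; rewrite unitfE.
by exists (fun=> 0%N); split=> // a a0; rewrite U.
Qed.

End MPolyFactorial.

(** * Restriction to lines *)

Section LinesAndDegrees.
Variable K : fieldType.
Implicit Types (f g h : {mpoly K[3]}) (p v w x : 'rV[K]_3).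

(** The restriction to a parametrised line is kept as a formal polynomial, since over a finite field
    its values do not determine it. *)
Definition mline p v : {mpoly K[3]} -> {poly K} :=
  mmap (@polyC K) (fun i => (p 0 i)%:P + v 0 i *: 'X).

HB.instance Definition _ p v := GRing.RMorphism.on (mline p v).

Lemma mlineC p v c : mline p v c%:MP = c%:P.
Proof. exact: mmapC. Qed.

Lemma mlineX p v i : mline p v 'X_i = (p 0 i)%:P + v 0 i *: 'X.
Proof. by rewrite /mline mmapX mmap1U. Qed.

Lemma mlineZ p v c f : mline p v (c *: f) = c *: mline p v f.
Proof. by rewrite -mul_mpolyC rmorphM /= mlineC mul_polyC. Qed.

Lemma mline_eval p v f s : (mline p v f).[s] = f.@[(p + s *: v) 0].
Proof.
pose F : {rmorphism {mpoly K[3]} -> K} := horner_eval s \o mline p v.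
pose G : {rmorphism {mpoly K[3]} -> K} := meval ((p + s *: v) 0).
apply: (@mpoly_rmorph_eq K 3 _ F G) => [c|i]; rewrite /F /G /= /horner_eval.
  by rewrite mlineC hornerC mevalC.
by rewrite mlineX mevalXU !mxE !hornerE mulrC.
Qed.

Lemma mline_eval0 p v f : (mline p v f).[0] = f.@[p 0].
Proof. by rewrite mline_eval scale0r addr0. Qed.

Lemma size_mline p v f : (size (mline p v f) <= msize f)%N.
Proof.
rewrite /mline /mmap; apply: (leq_trans (size_sum _ _ _)).
rewrite big_seq; elim/big_ind: _ => // [a b ha hb|m hm].
  by rewrite geq_max ha.
rewrite mul_polyC (leq_trans (size_scale_leq _ _)) //.
apply: leq_trans (msize_mdeg_lt hm); rewrite mdegE /mmap1.
elim/big_ind2: _ => [|a1 a2 b1 b2 h1 h2|i _]; first by rewrite size_poly1.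
  apply: (leq_trans (size_polyMleq _ _)); move: h1 h2; clear; lia.
apply: (leq_trans (size_poly_exp_leq _ _)); rewrite ltnS.
have : (size ((p 0 i)%:P + v 0 i *: 'X)%R <= 2)%N.
  apply: (leq_trans (size_polyD _ _)); rewrite geq_max.
  rewrite (leq_trans (size_polyC_leq1 _)) //.
  by rewrite (leq_trans (size_scale_leq _ _)) // size_polyX.
move: (size _) => n hn; rewrite -[leqRHS]mul1n leq_mul2r; apply/orP; right; lia.
Qed.

Definition mdir w f : {mpoly K[3]} := \sum_i w 0 i *: f^`M(i).

Lemma mdirM w f g : mdir w (f * g) = mdir w f * g + f * mdir w g.
Proof.
rewrite /mdir mulr_suml mulr_sumr -big_split; apply: eq_bigr => i _ /=.
by rewrite mderivM scalerDr -scalerAl -scalerAr.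
Qed.

Lemma mdirD w f g : mdir w (f + g) = mdir w f + mdir w g.
Proof.
rewrite /mdir -big_split; apply: eq_bigr => i _ /=.
by rewrite mderivD scalerDr.
Qed.

Lemma mdirC w c : mdir w c%:MP = 0.
Proof. by rewrite /mdir big1 // => i _; rewrite mderivC scaler0. Qed.

Lemma mdirX w i : mdir w 'X_i = (w 0 i)%:MP.
Proof.
rewrite /mdir (bigD1 i) //= big1 => [|j ji].
  rewrite addr0 mderivX mnm1E eqxx scale1r.
  have -> : (U_(i) - U_(i) = 0 :> 'X_{1..3})%MM.
    by apply/mnmP => j; rewrite mnmBE mnm0E subnn.
  by rewrite mpolyX0 -mul_mpolyC mulr1.
by rewrite mderivX mnm1E eq_sym (negbTE ji) scale0r scaler0.
Qed.

Lemma mline_mdir p v f : mline p v (mdir v f) = (mline p v f)^`().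
Proof.
elim/mpolyind: f => [|c m f _ _ IH]; first by rewrite -(mpolyC0 3 K) mdirC !rmorph0 deriv0.
rewrite mdirD !rmorphD /= derivD IH; congr (_ + _).
rewrite -mul_mpolyC mdirM mdirC mul0r add0r !rmorphM /= !mlineC derivM derivC mul0r add0r.
congr (_ * _); rewrite mpolyXE_id.
elim/big_rec: _ => [|i h _ IHh].
  by rewrite -(mpolyC1 3 K) mdirC mlineC rmorph0 polyC1 derivC.
have IHe n : mline p v (mdir v ('X_i ^+ n)) = (mline p v ('X_i ^+ n))^`().
  elim: n => [|n IHn].
    by rewrite expr0 -(mpolyC1 3 K) mdirC mlineC rmorph0 polyC1 derivC.
  rewrite exprS mdirM rmorphD !rmorphM /= IHn derivM /=; congr (_ * _ + _).
  by rewrite mdirX mlineX mlineC derivD derivC derivZ derivX add0r alg_polyC.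
by rewrite mdirM rmorphD !rmorphM /= IHh IHe derivM.
Qed.

Lemma msizeM_leq (a b : nat) f g :
  (msize f <= a.+1)%N -> (msize g <= b.+1)%N -> (msize (f * g) <= (a + b).+1)%N.
Proof.
have [->|f0] := eqVneq f 0; first by rewrite mul0r msize0.
have [->|g0] := eqVneq g 0; first by rewrite mulr0 msize0.
have aux i j : (i <= a.+1 -> j <= b.+1 -> (i + j).-1 <= (a + b).+1)%N by lia.
by rewrite msizeM //; apply: aux.
Qed.

Lemma msize_gt0 f : (0 < msize f)%N = (f != 0).
Proof. by rewrite lt0n msize_poly_eq0. Qed.

Lemma msize_sum_leq (I : Type) (r : seq I) (P : pred I) (F : I -> {mpoly K[3]}) n :
  (forall i, P i -> (msize (F i) <= n)%N) -> (msize (\sum_(i <- r | P i) F i)%R <= n)%N.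
Proof.
move=> h; elim/big_ind: _ => [|a b ha hb|//]; first by rewrite msize0.
by rewrite (leq_trans (msizeD_le _ _)) // geq_max ha.
Qed.

Lemma msize_mderiv i f : (msize f^`M(i) <= (msize f).-1)%N.
Proof.
rewrite /mderiv; rewrite big_seq; apply: msize_sum_leq => m hm.
have [mi|mi] := eqVneq (m i) 0%N; first by rewrite mi mul0r scale0r msize0.
apply: (leq_trans (msizeZ_le _ _)); rewrite msizeX.
have e : mdeg m = (mdeg (m - U_(i)) + 1)%N.
  rewrite -[X in (_ + X)%N](mdeg1 i) -mdegD submK //.
  by apply/mnm_lepP => j; rewrite mnm1E; case: eqP => // <-; rewrite lt0n.
by have := msize_mdeg_lt hm; rewrite e addn1; case: (msize f).
Qed.

End LinesAndDegrees.

(** * Dimension counts and Bezout's theorem for lines *)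

(** Rank-nullity for a sequence exact at [V]. All Hilbert function counts go through it, so that no
    basis is ever chosen. *)
Lemma dim_le_ker_image (K : fieldType) (U V W : vectType K) (a : U -> V) (b : V -> W) :
  linear a -> linear b -> (forall v, b v = 0 -> exists u, v = a u) ->
  (dim V <= dim U + dim W)%N.
Proof.
move=> la lb ab.
pose a' : {linear U -> V} := HB.pack a (GRing.isLinear.Build _ _ _ _ a la).
pose b' : {linear V -> W} := HB.pack b (GRing.isLinear.Build _ _ _ _ b lb).
have := limg_ker_dim (linfun b') fullv; rewrite dimvf capfv => <-.
apply: leq_add; last by rewrite -(dimvf W) dimvS ?subvf.
have h : (lker (linfun b') <= limg (linfun a'))%VS.
  apply/subvP => v; rewrite memv_ker lfunE /= => /eqP /ab [u ->].
  by rewrite -[a u](lfunE a') memv_img ?memvf.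
apply: (leq_trans (dimvS h)); rewrite -(dimvf U) -(limg_ker_dim (linfun a') fullv).
exact: leq_addl.
Qed.

Lemma dim_rV (K : fieldType) (n : nat) : dim 'rV[K]_n = n.
Proof. by rewrite dim_matrix [LHS]mul1n. Qed.

Section MonomialSpace.
Variable K : fieldType.
Implicit Types (f g h : {mpoly K[3]}) (p v w x : 'rV[K]_3).

(* Coefficient vectors of polynomials of degree < t, that is, of [msize] at most t. *)
Definition mspace (t : nat) := {ffun 'X_{1..3 < t} -> K^o}.

Definition mpoly_of (t : nat) (u : mspace t) : {mpoly K[3]} := \sum_m u m *: 'X_[m].

Definition mspace_of (t : nat) f : mspace t := [ffun m : 'X_{1..3 < t} => f@_m].

Lemma mpoly_of_linear t : linear (@mpoly_of t).
Proof.
move=> c u w; rewrite /mpoly_of scaler_sumr -big_split; apply: eq_bigr => m _ /=.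
by rewrite !ffunE scalerDl scalerA.
Qed.

HB.instance Definition _ t :=
  GRing.isLinear.Build K (mspace t) {mpoly K[3]} _ (@mpoly_of t) (@mpoly_of_linear t).

Lemma mspace_of_linear t : linear (@mspace_of t).
Proof. by move=> c f g; apply/ffunP => m; rewrite !ffunE mcoeffD mcoeffZ. Qed.

HB.instance Definition _ t :=
  GRing.isLinear.Build K {mpoly K[3]} (mspace t) _ (@mspace_of t) (@mspace_of_linear t).

Lemma mspace_ofK t f : (msize f <= t)%N -> mpoly_of (mspace_of t f) = f.
Proof.
move=> h; rewrite [RHS](mpolywE h); apply: eq_bigr => m _; by rewrite ffunE.
Qed.

Lemma msize_mpoly_of t (u : mspace t) : (msize (mpoly_of u) <= t)%N.
Proof.
apply: msize_sum_leq => m _; apply: (leq_trans (msizeZ_le _ _)).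
by rewrite msizeX bmdeg.
Qed.

Lemma mpoly_ofK t (u : mspace t) : mspace_of t (mpoly_of u) = u.
Proof.
apply/ffunP => m; rewrite ffunE /mpoly_of.
have := @mcoeff_mpoly 3 K (fun m' => if insub m' is Some b then u b else 0) m t (bmdeg m).
rewrite (eq_bigr (fun m0 : 'X_{1..3 < t} => u m0 *: 'X_[m0])) ?valK // => i _.
by rewrite valK.
Qed.

Lemma mspace_of_eq0 t f : (msize f <= t)%N -> mspace_of t f = 0 -> f = 0.
Proof. by move=> h e; rewrite -(mspace_ofK h) e linear0. Qed.

Lemma card_bmultinom t : #|{: 'X_{1..3 < t}}| = 'C(t.+2, 3).
Proof.
case: t => [|t].
  by apply: eq_card0 => -[m hm].
rewrite -[t.+3]/(3 + t)%N -card_partial_ord_partitions.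
pose F (m : 'X_{1..3 < t.+1}) : 3.-tuple 'I_t.+1 := [tuple inord (m i) | i < 3].
have ltF (m : 'X_{1..3 < t.+1}) i : (m i < t.+1)%N.
  apply: leq_ltn_trans (bmdeg m); rewrite mdegE (bigD1 i) //=; exact: leq_addr.
have Finj : injective F.
  move=> m1 m2 e; apply/val_inj/mnmP => i.
  have := congr1 (fun s => nat_of_ord (tnth s i)) e.
  by rewrite /F !tnth_mktuple !inordK.
rewrite -(card_imset _ Finj); apply: eq_card => s; rewrite inE.
apply/imsetP/idP => [[m _ ->]|hs].
  have := bmdeg m; rewrite ltnS mdegE => h.
  by rewrite big_tuple (eq_bigr (fun i => m i)) // => i _; rewrite tnth_mktuple inordK.
have hm : (mdeg [multinom val (tnth s i) | i < 3] < t.+1)%N.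
  rewrite ltnS mdegE (eq_bigr (fun i => val (tnth s i))) => [|i _]; last by rewrite mnmE.
  by move: hs; rewrite big_tuple.
exists (BMultinom hm) => //; apply/eq_from_tnth => i.
by rewrite tnth_mktuple mnmE inord_val.
Qed.

Lemma dim_mspace t : dim (mspace t) = 'C(t.+2, 3).
Proof. by rewrite -card_bmultinom -[RHS]muln1. Qed.

Lemma msizeM_irred f g : g != 0 -> f != 0 -> msize (g * f) = (msize g + (msize f).-1)%N.
Proof.
move=> g0 f0; rewrite msizeM //.
have : (0 < msize f)%N by rewrite msize_gt0.
by case: (msize f) => // n _; rewrite addnS.
Qed.

(** If evaluation at [Q] had its whole kernel among the multiples of [f], then [size Q] and the
    dimension of the space of cofactors would together fill the space of polynomials of degree below
    [e]. *)
Lemma exists_vanishing f (Q : seq 'rV[K]_3) (e : nat) : f != 0 ->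
  ((msize f).-1 <= e)%N ->
  (size Q + 'C((e - (msize f).-1).+2, 3) < 'C(e.+2, 3))%N ->
  exists g, [/\ (msize g <= e)%N, ~ divides f g & forall x, x \in Q -> g.@[x 0] = 0].
Proof.
move=> f0 fe lt; apply: contrapT => nex.
move: lt; rewrite ltnNge -!dim_mspace => /negP; apply.
pose a (u : mspace (e - (msize f).-1)) : mspace e := mspace_of e (mpoly_of u * f).
pose b (u : mspace e) : 'rV[K]_(size Q) := \row_i (mpoly_of u).@[(tnth (in_tuple Q) i) 0].
suff: (dim (mspace e) <= dim (mspace (e - (msize f).-1)) + dim 'rV[K]_(size Q))%N.
  by rewrite dim_rV addnC.
apply: (@dim_le_ker_image K _ _ _ a b).
- by move=> c u w; rewrite /a linearP mulrDl -scalerAl linearP.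
- by move=> c u w; apply/rowP => i; rewrite !mxE linearP mevalD mevalZ.
move=> u bu.
have [[q uq]|nd] := pselect (divides f (mpoly_of u)); last first.
  case: nex; exists (mpoly_of u); split=> //; first exact: msize_mpoly_of.
  move=> x /seq_tnthP [i ->].
  by have := congr1 (fun r : 'rV_(size Q) => r 0 i) bu; rewrite !mxE.
exists (mspace_of _ q); rewrite /a mspace_ofK -?uq ?mpoly_ofK //.
have [->|q0] := eqVneq q 0; first by rewrite msize0.
by have := msize_mpoly_of u; rewrite uq msizeM_irred // leq_subRL // addnC.
Qed.

End MonomialSpace.

Section Bezout.
Variable K : fieldType.
Implicit Types (f g h : {mpoly K[3]}) (p v w c : 'rV[K]_3).

Definition dotp c w : K := \sum_i c 0 i * w 0 i.

Lemma dotpDr c v w : dotp c (v + w) = dotp c v + dotp c w.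
Proof. by rewrite /dotp -big_split; apply: eq_bigr => i _; rewrite !mxE mulrDr. Qed.

Lemma dotpZr c s w : dotp c (s *: w) = s * dotp c w.
Proof. by rewrite /dotp mulr_sumr; apply: eq_bigr => i _; rewrite !mxE mulrCA. Qed.

Lemma dotpDl c v w : dotp (c + v) w = dotp c w + dotp v w.
Proof. by rewrite /dotp -big_split; apply: eq_bigr => i _; rewrite !mxE mulrDl. Qed.

Lemma dotpZl c s w : dotp (s *: c) w = s * dotp c w.
Proof. by rewrite /dotp mulr_sumr; apply: eq_bigr => i _; rewrite !mxE mulrA. Qed.

Lemma dotp_delta i w : dotp (delta_mx 0 i) w = w 0 i.
Proof.
rewrite /dotp (bigD1 i) //= mxE !eqxx mul1r big1 ?addr0 // => j ji.
by rewrite mxE (negbTE ji) andbF mul0r.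
Qed.

Lemma dotp0l w : dotp 0 w = 0.
Proof. by rewrite -(scale0r 0) dotpZl mul0r. Qed.

Lemma row_neq0 v : v != 0 -> exists i, v 0 i != 0.
Proof.
move=> v0; apply: contrapT => h; case/eqP: v0; apply/rowP => i; rewrite mxE.
by apply/eqP/negP => /negP hi; apply: h; exists i.
Qed.

Lemma nonparallel_minor v w : v != 0 -> (forall t, w != t *: v) ->
  exists a b, v 0 a * w 0 b - v 0 b * w 0 a != 0.
Proof.
move=> v0 wv; have [a va] := row_neq0 v0.
apply: contrapT => h; case/negP: (wv (w 0 a / v 0 a)); apply/eqP/rowP => b.
rewrite mxE; apply: (mulfI va); rewrite mulrA mulrCA mulfV // mulr1.
apply/eqP; rewrite -subr_eq0 [w 0 a * _]mulrC; apply/negP => /negP hb.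
by apply: h; exists a, b.
Qed.

Lemma separating_form v w : v != 0 -> (forall t, w != t *: v) ->
  exists c, dotp c v = 0 /\ dotp c w != 0.
Proof.
move=> v0 wv; have [a [b hab]] := nonparallel_minor v0 wv.
exists (v 0 a *: delta_mx 0 b + - v 0 b *: delta_mx 0 a).
rewrite !dotpDl !dotpZl !dotp_delta; split; last by rewrite mulNr.
by rewrite mulNr mulrC subrr.
Qed.

Definition affine_form c p : {mpoly K[3]} := \sum_i c 0 i *: ('X_i - (p 0 i)%:MP).

Lemma msize_affine_form c p : (msize (affine_form c p) <= 2)%N.
Proof.
apply: msize_sum_leq => i _; rewrite (leq_trans (msizeZ_le _ _)) //.
rewrite (leq_trans (msizeD_le _ _)) // msizeN geq_max msizeX mdeg1 /= msizeC.
by case: (_ != _).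
Qed.

Lemma mline_affine_form c q p v :
  mline p v (affine_form c q) = (dotp c (p - q))%:P + dotp c v *: 'X.
Proof.
rewrite /affine_form rmorph_sum /= /dotp rmorph_sum /= scaler_suml -big_split.
apply: eq_bigr => i _ /=; rewrite mlineZ rmorphB /= mlineX mlineC !mxE.
by rewrite addrAC -polyCB scalerDr scalerA -mul_polyC -polyCM.
Qed.

Definition same_line p v q w := forall s, exists t, q + s *: w = p + t *: v.

(** Some point of the second line is off the first; a plane through the first line that misses this
    point does it. *)
Lemma separating_affine_form p v q w : v != 0 -> ~ same_line p v q w ->
  exists l : {mpoly K[3]}, [/\ (msize l <= 2)%N, mline p v l = 0 & mline q w l != 0].
Proof.
move=> v0; rewrite /same_line => /existsNP [s hs].
have [t|c [cv cw]] := @separating_form v (q + s *: w - p) v0.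
  apply/eqP => e; apply: hs; exists t; by rewrite -e [RHS]addrC subrK.
exists (affine_form c p); split; first exact: msize_affine_form.
  by rewrite mline_affine_form subrr cv scale0r addr0 -(scale0r 0) dotpZr mul0r.
apply/negP => /eqP /(congr1 (horner^~ s)); rewrite mline_affine_form.
rewrite !hornerE mulrC -dotpZr -dotpDr addrAC => e.
by move: cw; rewrite e eqxx.
Qed.

(** Powers of such a form realise every polynomial in the parameter of the line. *)
Lemma coordinate_along p v : v != 0 ->
  exists2 l : {mpoly K[3]}, (msize l <= 2)%N & mline p v l = 'X.
Proof.
move=> v0; have [a va] := row_neq0 v0.
exists (affine_form ((v 0 a)^-1 *: delta_mx 0 a) p); first exact: msize_affine_form.
by rewrite mline_affine_form subrr !dotpZl !dotp_delta mulVf // scale1r mxE mulr0 add0r.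
Qed.

Lemma msize_exp_leq (l : {mpoly K[3]}) n : (msize l <= 2)%N -> (msize (l ^+ n) <= n.+1)%N.
Proof.
move=> hl; elim: n => [|n IH]; first by rewrite expr0 msize1.
by rewrite exprS; exact: (@msizeM_leq _ 1 n).
Qed.

Lemma msize_prod_leq (I : finType) (A : pred I) (F : I -> {mpoly K[3]}) :
  (forall i, (msize (F i) <= 2)%N) -> (msize (\prod_(i | A i) F i) <= #|A|.+1)%N.
Proof.
move=> hF; rewrite -sum1_card; elim/big_rec2: _ => [|i n h Ai IH].
  by rewrite msize1.
exact: (@msizeM_leq _ 1 n).
Qed.

Lemma binomial3 t : ('C(t.+2, 3) * 6 = t * t.+1 * t.+2)%N.
Proof.
have := bin_ffact t.+2 3; rewrite !ffactnS ffactn0 /=.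
by rewrite -[3`!]/6%N => ->; rewrite muln1 [RHS]mulnC [(t * _)%N]mulnC.
Qed.

(** The binomials form a mixed second difference of a cubic, at most ab(t + 1), whereas k(t - k)
    grows in t with slope k > ab; the lower bound on t lets the latter win. *)
Lemma bezout_arith a b k t : (a * b < k)%N -> (k ^ 2 + a * b + a + b < t)%N ->
  ('C((t - (a + b)).+2, 3) + 'C(t.+2, 3) <
   'C((t - a).+2, 3) + 'C((t - b).+2, 3) + k * (t - k))%N.
Proof.
rewrite expnS expn1 => hk ht. 
have kt : (k <= t)%N by move: (a * b)%N hk ht => c; case: k => // k; nia.
have hk' : (a * b * (t + 1) + 1 <= k * (t - k))%N.
  have [d dE] : exists d, (t = k + d)%N by exists (t - k)%N; lia.
  rewrite dE addKn; rewrite dE in ht; clear -hk ht.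
  move: (a * b)%N hk ht => c hk ht.
  have : (c.+1 * d <= k * d)%N by rewrite leq_mul2r hk orbT.
  have : (c * (k + 1) <= k * k - k + k * k)%N by nia.
  nia.
have [u tE] : exists u, (t = u + (a + b))%N by exists (t - (a + b))%N; lia.
have e1 : (t - (a + b) = u)%N by lia.
have e2 : (t - a = u + b)%N by lia.
have e3 : (t - b = u + a)%N by lia.
rewrite e1 e2 e3; rewrite {}tE in hk' *.
move: (k * _)%N hk' => X hk'; clear -hk'.
move: (binomial3 u) (binomial3 (u + (a + b))) (binomial3 (u + b)) (binomial3 (u + a)).
move: 'C(u.+2, 3) 'C((u + (a + b)).+2, 3) 'C((u + b).+2, 3) 'C((u + a).+2, 3).
move=> c1 c2 c3 c4 h1 h2 h3 h4.
have : (c1 * 6 + c2 * 6 <= c3 * 6 + c4 * 6 + 6 * (a * b * (u + (a + b) + 1)))%N.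
  rewrite h1 h2 h3 h4; lia.
lia.
Qed.

(* Hilbert function count. In degree < t the ideal (f, g) has codimension at most ab(t + 1),
   by exactness of the Koszul complex. The polynomials [ms M] below, products of planes
   isolating one line with a polynomial in a coordinate along that line, are independent
   modulo (f, g) and form a space of dimension k(t - k). *)
Lemma bezout_lines f g (k : nat) (p v : 'I_k -> 'rV[K]_3) :
  irred_elt f -> ~ divides f g ->
  (forall i, v i != 0) -> (forall i j, i != j -> ~ same_line (p i) (v i) (p j) (v j)) ->
  (forall i, mline (p i) (v i) f = 0) -> (forall i, mline (p i) (v i) g = 0) ->
  (k <= (msize f).-1 * (msize g).-1)%N.
Proof.
move=> firr nfg v0 pv lf lg.
have [f0 _ fP] := irred_prime (factorial_mpoly K 3) firr.
have g0 : g != 0 by apply/eqP => g0; apply: nfg; exists 0; rewrite g0 mul0r.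
rewrite leqNgt; apply/negP => hk.
set a := (msize f).-1 in hk; set b := (msize g).-1 in hk.
pose t := (k ^ 2 + a * b + a + b).+1.
have kt : (k <= t)%N.
  by rewrite /t expnS expn1 -!addnA; case: (k) => // n; rewrite mulSn -!addnA -addnS leq_addr.
have := bezout_arith hk (ltnSn (k ^ 2 + a * b + a + b)); rewrite -/t ltnNge => /negP; apply.
have /choice [l lP] (ij : 'I_k * 'I_k) : exists l : {mpoly K[3]}, (msize l <= 2)%N /\ (ij.1 != ij.2 ->
    mline (p ij.1) (v ij.1) l = 0 /\ mline (p ij.2) (v ij.2) l != 0).
  have [e|ne] := eqVneq ij.1 ij.2; first by exists 0; rewrite msize0.
  by have [l [l2 l0 l1]] := separating_affine_form (v0 ij.1) (pv _ _ ne); exists l.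
have /choice [x xP] (i : 'I_k) : exists x : {mpoly K[3]}, (msize x <= 2)%N /\ mline (p i) (v i) x = 'X.
  by have [x x2 xX] := coordinate_along (p i) (v0 i); exists x.
pose pr j := \prod_(i | i != j) l (i, j).
have pr_size j : (msize (pr j) <= k.-1.+1)%N.
  apply: leq_trans (msize_prod_leq _ _) _; first by move=> i; case: (lP (i, j)).
  by rewrite ltnS -[in leqRHS](card_ord k) cardC1.
have pr0 i j : i != j -> mline (p i) (v i) (pr j) = 0.
  move=> ij; rewrite /pr (bigD1 i) //= rmorphM /=.
  by have [_ /(_ ij) [-> _]] := lP (i, j); rewrite mul0r.
have prn0 j : mline (p j) (v j) (pr j) != 0.
  rewrite rmorph_prod /=; apply/prodf_neq0 => i ij.
  by have [_ /(_ ij) []] := lP (i, j).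
pose S := 'M[K]_(k, t - k).
pose ms (M : S) : {mpoly K[3]} := \sum_j pr j * \sum_s M j s *: x j ^+ s.
have ms_line M j : mline (p j) (v j) (ms M) =
    mline (p j) (v j) (pr j) * \poly_(s < t - k) (if insub s is Some s' then M j s' else 0).
  rewrite /ms rmorph_sum /= (bigD1 j) //= [X in _ + X]big1 => [|i ij]; last first.
    by rewrite rmorphM /= pr0 ?mul0r // eq_sym.
  rewrite addr0 rmorphM /=; congr (_ * _); rewrite rmorph_sum poly_def /=.
  by apply: eq_bigr => s _; rewrite mlineZ rmorphXn /= (xP j).2 valK.
have ms_size M : (msize (ms M) <= t)%N.
  apply: msize_sum_leq => j _.
  have hj := ltn_ord j.
  apply: leq_trans (@msizeM_leq _ k.-1 (t - k) _ _ (pr_size j) _) _; last by clear -hj kt; clearbody t; lia.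
  apply: msize_sum_leq => s _; apply: (leq_trans (msizeZ_le _ _)).
  apply: leq_trans (msize_exp_leq _ (xP j).1) _; have := ltn_ord s; lia.
have ms_lin : linear ms.
  move=> c M N; rewrite /ms scaler_sumr -big_split; apply: eq_bigr => j _ /=.
  rewrite scalerAr -mulrDr; congr (_ * _); rewrite scaler_sumr -big_split.
  by apply: eq_bigr => s _ /=; rewrite !mxE scalerDl scalerA.
pose U := mspace K (t - (a + b)).
pose V := (mspace K (t - a) * mspace K (t - b) * S)%type.
(* First Koszul map. The next one, [be], sends a pair to a combination of [f] and [g], with the
   independent family [ms] added. *)
pose al (u : U) : V :=
  (- mspace_of _ (mpoly_of u * g), mspace_of _ (mpoly_of u * f), 0).
pose be (y : V) : mspace K t :=
  mspace_of t (mpoly_of y.1.1 * f + mpoly_of y.1.2 * g + ms y.2).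
suff : (dim V <= dim U + dim (mspace K t))%N.
  have -> : dim V = (dim (mspace K (t - a)) + dim (mspace K (t - b)) + dim S)%N by [].
  by rewrite !dim_mspace dim_matrix.
have szM (u h : {mpoly K[3]}) d e : (d <= e)%N -> (msize u <= e - d)%N -> (msize h).-1 = d -> h != 0 ->
    (msize (u * h) <= e)%N.
  have [->|u0] := eqVneq u 0; first by rewrite mul0r msize0.
  by move=> de hu hc h0; rewrite msizeM_irred // hc addnC -leq_subRL.
apply: (@dim_le_ker_image K _ _ _ al be).
- move=> c u w; rewrite [RHS](_ : _ = (c *: (al u).1.1 + (al w).1.1,
    c *: (al u).1.2 + (al w).1.2, c *: 0 + 0)) // scaler0 addr0; congr (_, _, _) => /=.
    by rewrite linearP mulrDl -scalerAl linearP opprD scalerN.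
  by rewrite linearP mulrDl -scalerAl linearP.
- move=> c y z; rewrite /be -[RHS]linearP /=; congr (mspace_of t _).
  rewrite !linearP ms_lin !mulrDl !scalerDr -!scalerAl.
  by rewrite (addrACA (c *: _)) [LHS]addrACA.
move=> [[u w] M] /= /mspace_of_eq0 e.
have {}e : mpoly_of u * f + mpoly_of w * g + ms M = 0.
  apply: e; apply: leq_trans (msizeD_le _ _) _; rewrite geq_max ms_size andbT.
  apply: leq_trans (msizeD_le _ _) _; rewrite geq_max.
  apply/andP; split; [apply: (szM _ f a) => //|apply: (szM _ g b) => //];
    by [exact: msize_mpoly_of|rewrite /t; lia].
(* On the j-th line [f] and [g] vanish, and [ms M] restricts to a nonzero factor times the
   polynomial with coefficients the j-th row of [M]. *)
have M0 : M = 0.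
  apply/matrixP => j s; rewrite mxE.
  have := congr1 (mline (p j) (v j)) e.
  rewrite !rmorphD !rmorphM /= lf lg !mulr0 !add0r rmorph0 ms_line => /eqP.
  rewrite mulf_eq0 (negbTE (prn0 j)) /= => /eqP /(congr1 (fun q : {poly K} => q`_s)).
  by rewrite coef_poly ltn_ord valK coef0.
move: e; rewrite M0 /ms.
rewrite [X in _ + X]big1 => [|j _]; last first.
  by rewrite big1 ?mulr0 // => s _; rewrite mxE scale0r.
rewrite addr0 => e.
(* Koszul exactness: the prime [f] divides w g but not [g], so w = q f and then u = - q g. *)
have [|[q wq]|//] := fP (mpoly_of w) g.
  by exists (- mpoly_of u); rewrite mulNr; apply/eqP; rewrite -addr_eq0 addrC e.
have uq : mpoly_of u = - (q * g).
  apply: (mulIf f0); apply/eqP; rewrite -subr_eq0 -e wq.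
  by apply/eqP; ring.
have sq : (msize q <= t - (a + b))%N.
  have [->|q0] := eqVneq q 0; first by rewrite msize0.
  have aux i : (i + a <= t - b -> i <= t - (a + b))%N by clearbody t a b; lia.
  by apply: aux; rewrite -msizeM_irred // -wq msize_mpoly_of.
exists (mspace_of _ q); rewrite /al mspace_ofK // -wq mpoly_ofK.
by rewrite -(mpoly_ofK u) uq linearN.
Qed.

End Bezout.

(** * Lines as point sets *)

Section LineSets.
Variable K : fieldType.
Implicit Types (f g h : {mpoly K[3]}) (p v w c x : 'rV[K]_3) (l : set 'rV[K]_3).

Definition line_through p v : set 'rV[K]_3 := [set x | exists s, x = p + s *: v].

(* Base point and direction of a line, with junk value (0, 0) on other sets. *)
Definition lparam l : 'rV[K]_3 * 'rV[K]_3 :=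
  xget (0, 0) [set pv | pv.2 != 0 /\ l = line_through pv.1 pv.2].

Lemma is_lineP l : is_line l -> exists p v, v != 0 /\ l = line_through p v.
Proof.
move=> [p [V [dV ->]]].
have nV : V != 0%VS by rewrite -dimv_eq0 dV.
have v0 : vpick V != 0 by rewrite vpick0.
have VE : <[vpick V]>%VS = V.
  by apply/eqP; rewrite eqEdim -memvE memv_pick dV dim_vline v0.
exists p, (vpick V); split=> //; apply/seteqP; split=> x /=.
  have -> : (x - p \in V) = (x - p \in <[vpick V]>%VS) by rewrite VE.
  move=> /vlineP [s e].
  by exists s; rewrite -e addrC subrK.
by move=> [s ->]; rewrite addrC addKr memvZ // memv_pick.
Qed.

Lemma lparamP l : is_line l ->
  (lparam l).2 != 0 /\ l = line_through (lparam l).1 (lparam l).2.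
Proof.
move=> /is_lineP [p [v hv]].
exact: (@xgetPex _ (0, 0) [set pv : 'rV[K]_3 * 'rV[K]_3 | pv.2 != 0 /\
  l = line_through pv.1 pv.2] (ex_intro _ (p, v) hv)).
Qed.

(** Formal vanishing, which over a finite field is stronger than vanishing at all points of the
    line; [vanish_of_roots] recovers it from enough zeros. *)
Definition vanish f l : bool := mline (lparam l).1 (lparam l).2 f == 0.

Lemma vanishM f g l : vanish (f * g) l = vanish f l || vanish g l.
Proof. by rewrite /vanish rmorphM mulf_eq0. Qed.

Lemma vanish_prod (I : Type) (r : seq I) (F : I -> {mpoly K[3]}) l :
  vanish (\prod_(i <- r) F i) l = has (fun i => vanish (F i) l) r.
Proof.
elim: r => [|i r IH]; first by rewrite big_nil /vanish rmorph1 oner_eq0.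
by rewrite big_cons vanishM IH.
Qed.

Lemma vanish_point f l x : is_line l -> vanish f l -> l x -> f.@[x 0] = 0.
Proof.
move=> /lparamP [v0 lE] /eqP fl; rewrite lE => -[s ->].
by rewrite -mline_eval fl horner0.
Qed.

Lemma vanish_of_roots f l (Q : seq 'rV[K]_3) : is_line l -> uniq Q ->
  (forall x, x \in Q -> l x /\ f.@[x 0] = 0) -> (msize f <= size Q)%N -> vanish f l.
Proof.
move=> /lparamP [v0 lE] uQ hQ sQ; rewrite /vanish.
set p := (lparam l).1 in lE *; set v := (lparam l).2 in v0 lE *.
have /choice [s sP] x : exists s, x \in Q -> x = p + s *: v.
  have [/hQ [lx _]|] := boolP (x \in Q); last by exists 0.
  by move: lx; rewrite lE => -[s ->]; exists s.
apply/eqP; apply: (@roots_geq_poly_eq0 _ _ (map s Q)).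
- apply/allP => _ /mapP [x xQ ->]; rewrite /root mline_eval -sP //.
  by have [_ ->] := hQ x xQ.
- rewrite map_inj_in_uniq // => x y xQ yQ e.
  by rewrite (sP x xQ) (sP y yQ) e.
- by rewrite size_map (leq_trans (size_mline _ _ _)).
Qed.

Lemma zeros_on_line f l (Q : seq 'rV[K]_3) : is_line l -> uniq Q -> ~~ vanish f l ->
  (count (fun x => (x \in l) && (f.@[x 0] == 0)%R) Q <= (msize f).-1)%N.
Proof.
move=> ll uQ; apply: contraNleq; rewrite -size_filter => h.
apply: (@vanish_of_roots f l [seq x <- Q | (x \in l) && (f.@[x 0] == 0)]);
  rewrite ?filter_uniq //; last first.
  by move: h; case: (msize f).
by move=> x; rewrite mem_filter => /andP [/andP [/set_mem xl /eqP fx] _].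
Qed.

Lemma same_line_eq l l' : is_line l -> is_line l' ->
  same_line (lparam l).1 (lparam l).2 (lparam l').1 (lparam l').2 -> l = l'.
Proof.
move=> /lparamP; set p := (lparam l).1; set v := (lparam l).2 => -[v0 lE].
move=> /lparamP; set q := (lparam l').1; set w := (lparam l').2 => -[w0 lE'].
rewrite lE lE' => {lE lE'} h.
have [t0] := h 0; rewrite scale0r addr0 => q0.
have [t1] := h 1; rewrite scale1r => q1.
have wE : w = (t1 - t0) *: v.
  by apply: (addrI q); rewrite q1 q0 scalerBl -addrA [X in _ = _ + X]addrC subrK.
have t10 : t1 - t0 != 0 by apply: contra_neq w0 => t10; rewrite wE t10 scale0r.
apply/seteqP; split=> x [s ->]; last exact: h.
exists ((s - t0) / (t1 - t0)); rewrite wE scalerA divfK // q0 scalerBl.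
by rewrite -addrA [t0 *: v + _]addrC subrK.
Qed.

Lemma bezout_sets f g (M : seq (set 'rV[K]_3)) :
  irred_elt f -> ~ divides f g -> uniq M -> (forall l, l \in M -> is_line l) ->
  (forall l, l \in M -> vanish f l) -> (forall l, l \in M -> vanish g l) ->
  (size M <= (msize f).-1 * (msize g).-1)%N.
Proof.
move=> firr nfg uM lM fM gM.
pose ll (i : 'I_(size M)) := tnth (in_tuple M) i.
have llM i : ll i \in M by apply: mem_tnth.
apply: (@bezout_lines _ f g _ (fun i => (lparam (ll i)).1) (fun i => (lparam (ll i)).2)) => //.
- by move=> i; have [] := lparamP (lM _ (llM i)).
- move=> i j ij /same_line_eq -/(_ (lM _ (llM i)) (lM _ (llM j))) e.
  by move/eqP: e; rewrite /ll !(tnth_nth set0) nth_uniq //= (inj_eq val_inj) (negbTE ij).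
- by move=> i; apply/eqP/fM.
- by move=> i; apply/eqP/gM.
Qed.

(** Double counting of incidences between the lines of [M] and the good points of [Q]. *)
Lemma incidence_count (R : realFieldType) (M : seq (set 'rV[K]_3)) (Q : seq 'rV[K]_3)
    (good : pred 'rV[K]_3) (A : R) (k : nat) :
  (forall l, l \in M -> A <= (count (fun x => (x \in l) && good x) Q)%:R) ->
  (forall x, x \in Q -> good x -> (count (fun l => x \in l) M <= k)%N) ->
  (size M)%:R * A <= k%:R * (size Q)%:R.
Proof.
move=> hA hk.
have -> : (size M)%:R * A = \sum_(l <- M) A.
  by rewrite big_const_seq count_predT iter_addr_0 mulr_natl.
apply: (@le_trans _ _ (\sum_(l <- M) (count (fun x => (x \in l) && good x) Q)%:R)).
  by rewrite !big_seq; apply: ler_sum => l; apply: hA.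
rewrite -natr_sum -natrM ler_nat.
rewrite (eq_bigr (fun l => \sum_(x <- Q | good x) (x \in l : nat)))%N; last first.
  move=> l _; rewrite -sum1_count big_mkcond [RHS]big_mkcond /=.
  by apply: eq_bigr => x _; case: (x \in l); case: (good x).
rewrite exchange_big /=.
apply: (@leq_trans (\sum_(x <- Q | good x) k)%N).
  rewrite !(big_seq_cond good); apply: leq_sum => x /andP [xQ gx].
  rewrite -[leqRHS]/k; apply: leq_trans (hk _ xQ gx).
  by rewrite -sum1_count [leqRHS]big_mkcond; apply: leq_sum => l _; case: (x \in l).
by rewrite big_const_seq iter_addn_0 leq_mul2l count_size orbT.
Qed.

Lemma msize_sub1_gt0 f : irred_elt f -> (0 < (msize f).-1)%N.
Proof.
move=> [f0 fU _]; rewrite -subn1 subn_gt0 ltnNge; apply/negP => s1.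
move: f0 fU; rewrite (msize1_polyC s1) mpolyC_eq0 => c0.
by rewrite rmorph_unit ?unitfE.
Qed.

Lemma msize_divides f g : divides f g -> g != 0 -> (msize f <= msize g)%N.
Proof.
move=> [q ->]; rewrite mulf_eq0 => /norP [q0 f0]; rewrite msizeM_irred //.
have : (0 < msize q)%N by rewrite msize_gt0.
by case: (msize q) => // n _; case: (msize f) => // k /=; rewrite addSn ltnS leq_addl.
Qed.

(** [g] has least degree among the polynomials vanishing on [Q] and not divisible by [f]. The
    binomial inequality is the failure of the count in [exists_vanishing] one degree lower. *)
Lemma cutting_degree f (Q : seq 'rV[K]_3) : irred_elt f ->
  (forall g, g != 0 -> (forall x, x \in Q -> g.@[x 0] = 0) -> (msize f <= msize g)%N) ->
  exists g, [/\ ~ divides f g, forall x, x \in Q -> g.@[x 0] = 0,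
    ((msize f).-1 <= (msize g).-1)%N &
    ('C((msize g).-1.+2, 3) <= size Q + 'C(((msize g).-1 - (msize f).-1).+2, 3))%N].
Proof.
move=> firr fmin; have a0 := msize_sub1_gt0 firr; have [f0 _ _] := firr.
pose cuts g := ~ divides f g /\ forall x, x \in Q -> g.@[x 0] = 0.
have : exists n, `[< exists2 g, cuts g & msize g = n >].
  pose e := (size Q + (msize f).-1).+1.
  have [||g [_ ng gQ]] := @exists_vanishing K f Q e f0.
  - by rewrite /e -addSn leq_addl.
  - have -> : (e - (msize f).-1 = (size Q).+1)%N by rewrite /e -addSn addnK.
    move: (binomial3 e) (binomial3 (size Q).+1).
    move: 'C(e.+2, 3) 'C((size Q).+3, 3) => c1 c2; rewrite /e.
    move: (size Q) (msize f).-1 a0 => n a a0; case: a a0 => // a _ h1 h2; nia.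
  by exists (msize g); apply/asboolP; exists g.
case/ex_minnP => n /asboolP [g [ng gQ] sg] gmin; exists g.
have g0 : g != 0 by apply/eqP => g0; apply: ng; exists 0; rewrite g0 mul0r.
have fg := fmin g g0 gQ.
split=> //; first by rewrite -!subn1 leq_sub2r.
rewrite leqNgt; apply/negP => lt.
have [|g' [sg' ng' gQ']] := @exists_vanishing K f Q (msize g).-1 f0 _ lt.
  by rewrite -!subn1 leq_sub2r.
have : (n <= msize g')%N by apply: gmin; apply/asboolP; exists g'.
by rewrite leqNgt (leq_ltn_trans sg') // sg prednK // -sg msize_gt0.
Qed.

(** Let e be the degree of the cutting polynomial and r = e - a. If e < A + a, it has more zeros
    than its degree on each line, and Bezout applies. Otherwise r >= A, and the term 3 a r^2 of e^3
    - r^3 is at most 6 times the number of points. *)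
Lemma component_dichotomy (R : realFieldType) f (Q : seq 'rV[K]_3)
    (M : seq (set 'rV[K]_3)) (A : R) : irred_elt f -> uniq Q -> uniq M ->
  (forall g, g != 0 -> (forall x, x \in Q -> g.@[x 0] = 0) -> (msize f <= msize g)%N) ->
  (forall l, l \in M -> is_line l) -> (forall l, l \in M -> vanish f l) ->
  (forall l, l \in M -> A + ((msize f).-1)%:R <= (count (fun x => x \in l) Q)%:R) ->
  0 <= A ->
  (exists e : R, [/\ 0 <= e, (size M)%:R <= ((msize f).-1)%:R * e &
      ((msize f).-1)%:R * e ^+ 2 <= 6 * (size Q)%:R]) \/
  ((msize f).-1)%:R * A ^+ 2 <= 2 * (size Q)%:R.
Proof.
move=> firr uQ uM fmin lM fM rich A0.
have [g [ng gQ]] := cutting_degree firr fmin.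
set a := (msize f).-1 in rich *; set e := (msize g).-1; set n := size Q.
move=> ae hD.
have [r eE] : exists r, e = (a + r)%N by exists (e - a)%N; rewrite subnKC.
(* Multiplied by 6, [hD] compares e(e + 1)(e + 2) with r(r + 1)(r + 2); the lower-order terms help
   because r <= e. *)
have hn : (e ^ 3 <= 6 * n + r ^ 3)%N.
  move: hD (binomial3 e) (binomial3 r); rewrite {2}eE addKn.
  move: 'C(e.+2, 3) 'C(r.+2, 3) => c1 c2 h1 h2 h3.
  have : (r <= e)%N by lia.
  rewrite !expnS expn0 !muln1; nia.
have hnR : (a%:R + r%:R) ^+ 3 <= 6 * n%:R + r%:R ^+ 3 :> R.
  by move: hn; rewrite -(ler_nat R) natrD natrM !natrX eE natrD.
have aR : 0 <= a%:R :> R by rewrite ler0n.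
have rR : 0 <= r%:R :> R by rewrite ler0n.
have nR : 0 <= n%:R :> R by rewrite ler0n.
have [ltB|geB] := ltP (e%:R : R) (A + a%:R); [left|right].
  exists e%:R; rewrite ler0n; split=> //.
    rewrite -natrM ler_nat; apply: bezout_sets => // l lM'.
    apply: (@vanish_of_roots _ _ [seq x <- Q | x \in l] (lM _ lM')).
      exact: filter_uniq.
      by move=> x; rewrite mem_filter => /andP [/set_mem xl xQ]; split=> //; apply: gQ.
    have g0 : g != 0 by apply/eqP => g0; apply: ng; exists 0; rewrite g0 mul0r.
    rewrite size_filter -(prednK (_ : 0 < msize g)%N) ?msize_gt0 //.
    by rewrite -(ltr_nat R); apply: lt_le_trans ltB (rich _ lM').
  by rewrite eE natrD; nra.
have hA : A <= r%:R by move: geB; rewrite eE natrD [X in _ <= X]addrC lerD2r.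
have h1 : a%:R * A ^+ 2 <= a%:R * r%:R ^+ 2 by rewrite ler_wpM2l // ler_pXn2r.
have h2 : 0 <= a%:R ^+ 2 * r%:R :> R by rewrite mulr_ge0 // exprn_ge0.
have h3 : 0 <= a%:R ^+ 3 :> R by rewrite exprn_ge0.
have h4 : (a%:R + r%:R) ^+ 3 =
    a%:R ^+ 3 + 3 * (a%:R ^+ 2 * r%:R) + 3 * (a%:R * r%:R ^+ 2) + r%:R ^+ 3 :> R by ring.
lra.
Qed.

End LineSets.

(** * Tangent planes and flat points *)

Section LocalGeometry.
Variable K : fieldType.
Implicit Types (f g h : {mpoly K[3]}) (p v w c x : 'rV[K]_3) (l : set 'rV[K]_3).

Definition grad f x : 'rV[K]_3 := \row_i f^`M(i).@[x 0].

Lemma mdir_eval w f x : (mdir w f).@[x 0] = dotp (grad f x) w.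
Proof.
rewrite /mdir /dotp raddf_sum /=; apply: eq_bigr => i _.
by rewrite mevalZ mxE mulrC.
Qed.

Lemma mdir_lin (a b : K) v w f : mdir (a *: v + b *: w) f = a *: mdir v f + b *: mdir w f.
Proof.
rewrite /mdir !scaler_sumr -big_split; apply: eq_bigr => i _ /=.
by rewrite !mxE scalerDl !scalerA.
Qed.

Lemma mdir_comm v w f : mdir v (mdir w f) = mdir w (mdir v f).
Proof.
rewrite /mdir (eq_bigr (fun i => \sum_j (v 0 i * w 0 j) *: f^`M(j)^`M(i))); last first.
  move=> i _; rewrite (raddf_sum (mderiv i)) /= scaler_sumr; apply: eq_bigr => j _ /=.
  by rewrite mderivZ scalerA.
rewrite exchange_big /=; apply: eq_bigr => j _.
rewrite (raddf_sum (mderiv j)) /= scaler_sumr; apply: eq_bigr => i _ /=.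
by rewrite mderivZ scalerA mulrC mderiv_comm.
Qed.

Lemma mline_shift p v s f :
  mline (p + s *: v) v f = mline p v f \Po ('X + s%:P).
Proof.
pose F : {rmorphism {mpoly K[3]} -> {poly K}} := mline (p + s *: v) v.
pose G : {rmorphism {mpoly K[3]} -> {poly K}} := comp_poly ('X + s%:P) \o mline p v.
apply: (@mpoly_rmorph_eq K 3 _ F G) => [c|i]; rewrite /F /G /=.
  by rewrite !mlineC comp_polyC.
rewrite !mlineX comp_polyD comp_polyC comp_polyZ comp_polyX !mxE.
by rewrite polyCD scalerDr -addrA; congr (_ + _); rewrite addrC mulrC polyCM mul_polyC.
Qed.

Definition ldir l := (lparam l).2.

Lemma ldir_neq0 l : is_line l -> ldir l != 0.
Proof. by move=> /lparamP []. Qed.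

Lemma vanish_at f l x : is_line l -> l x -> vanish f l -> mline x (ldir l) f = 0.
Proof.
move=> /lparamP [_ lE] lx /eqP fl.
have [s ->] : line_through (lparam l).1 (lparam l).2 x by rewrite -lE.
by rewrite /ldir mline_shift fl comp_poly0.
Qed.

Lemma line_rebase l x : is_line l -> l x -> l = line_through x (ldir l).
Proof.
move=> /lparamP [_]; rewrite /ldir; set p := (lparam l).1; set v := (lparam l).2.
move=> -> -[s ->]; apply/seteqP; split=> y [t ->].
  by exists (t - s); rewrite -addrA -scalerDl [s + _]addrC subrK.
by exists (s + t); rewrite -addrA -scalerDl.
Qed.

Lemma ldir_nonparallel l l' x : is_line l -> is_line l' -> l x -> l' x -> l != l' ->
  forall t, ldir l' != t *: ldir l.
Proof.
move=> ll ll' lx lx' nll' t; apply: contra_neq nll' => e.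
have t0 : t != 0.
  by apply: contra_neq (ldir_neq0 ll') => t0; rewrite e t0 scale0r.
rewrite (line_rebase ll lx) (line_rebase ll' lx') e.
apply/seteqP; split=> y [s ->].
  by exists (s / t); rewrite scalerA divfK.
by exists (s * t); rewrite scalerA.
Qed.

Lemma dotp_linear c : linear (dotp c : 'rV[K]_3 -> K^o).
Proof. by move=> a v w; rewrite dotpDr dotpZr. Qed.

HB.instance Definition _ c :=
  GRing.isLinear.Build K 'rV[K]_3 K^o _ (dotp c : 'rV[K]_3 -> K^o) (dotp_linear c).

Lemma dotpC c v : dotp c v = dotp v c.
Proof. by apply: eq_bigr => i _; rewrite mulrC. Qed.

Definition orthogonal_plane c : {vspace 'rV[K]_3} := lker (linfun (dotp c : 'rV[K]_3 -> K^o)).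

Lemma mem_orthogonal_plane c v : (v \in orthogonal_plane c) = (dotp c v == 0).
Proof. by rewrite memv_ker lfunE. Qed.

Lemma dim_orthogonal_plane c : c != 0 -> \dim (orthogonal_plane c) = 2.
Proof.
move=> /row_neq0 [i ci].
have := limg_ker_dim (linfun (dotp c : 'rV[K]_3 -> K^o)) fullv.
rewrite capfv dimvf dim_rV.
suff -> : \dim (limg (linfun (dotp c : 'rV[K]_3 -> K^o))) = 1%N.
  by rewrite addn1 => -[].
apply/eqP; rewrite eqn_leq; apply/andP; split.
  by apply: leq_trans (dimvS (subvf _)) _; rewrite dimvf.
rewrite lt0n dimv_eq0; apply/eqP => e.
have : linfun (dotp c : 'rV[K]_3 -> K^o) (delta_mx 0 i) \in
    limg (linfun (dotp c : 'rV[K]_3 -> K^o)) by rewrite memv_img ?memvf.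
by rewrite e memv0 lfunE /= dotpC dotp_delta (negbTE ci).
Qed.

Lemma orthogonal_span c v w x : c != 0 -> v != 0 -> (forall t, w != t *: v) ->
  dotp c v = 0 -> dotp c w = 0 -> dotp c x = 0 -> exists a b : K, x = a *: v + b *: w.
Proof.
move=> c0 v0 wv cv cw cx.
have fr : free [:: w; v].
  rewrite free_cons span_seq1 free_cons span_nil memv0 v0 nil_free.
  rewrite !andbT; apply/negP => /vlineP [t e].
  by have := wv t; rewrite e eqxx.
have e : (<[w]> + <[v]>)%VS = orthogonal_plane c.
  apply/eqP; rewrite eqEdim; apply/andP; split.
    by rewrite subv_add -!memvE !mem_orthogonal_plane cv cw eqxx.
  rewrite dim_orthogonal_plane //.
  by move: fr; rewrite /free span_cons span_seq1 => /eqP ->.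
have : x \in orthogonal_plane c by rewrite mem_orthogonal_plane cx.
rewrite -e => /memv_addP [_ /vlineP [b ->] [_ /vlineP [a ->] ->]].
by exists a, b; rewrite addrC.
Qed.

(** The two coordinates other than [i] parametrise the plane orthogonal to [c]. This normal form
    makes the directions w1 + j w2 visibly nonparallel for distinct j. *)
Lemma orthogonal_basis c i : c 0 i != 0 ->
  exists w1 w2 (b1 b2 : 'I_3), [/\ dotp c w1 = 0, dotp c w2 = 0,
    w1 0 b1 = c 0 i /\ w1 0 b2 = 0 & w2 0 b1 = 0 /\ w2 0 b2 = c 0 i].
Proof.
move=> ci.
have [b1 [b2 [b1i b2i b12]]] : exists b1 b2 : 'I_3, [/\ b1 != i, b2 != i & b1 != b2].
  by exists (i + 1), (i + 1 + 1); clear ci; case: i => [[|[|[|]]]].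
pose w b : 'rV[K]_3 := c 0 i *: delta_mx 0 b + - c 0 b *: delta_mx 0 i.
have wE b j : j != i -> w b 0 j = c 0 i * (j == b)%:R.
  by move=> ji; rewrite !mxE /= (negbTE ji) mulr0 addr0.
have w0 b : dotp c (w b) = 0.
  by rewrite dotpDr !dotpZr ![dotp c (delta_mx _ _)]dotpC !dotp_delta; ring.
exists (w b1), (w b2), b1, b2; rewrite !w0 !wE // !eqxx (negbTE b12).
by rewrite [b2 == b1]eq_sym (negbTE b12) !mulr0 !mulr1.
Qed.

Lemma vanish_grad f l x : is_line l -> l x -> vanish f l -> dotp (grad f x) (ldir l) = 0.
Proof.
move=> ll lx fl; rewrite -mdir_eval -(mline_eval0 x (ldir l)) mline_mdir.
by rewrite (vanish_at ll lx fl) deriv0 horner0.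
Qed.

Lemma tangent_form_vanish f l x : is_line l -> l x -> vanish f l ->
  vanish (affine_form (grad f x) x) l.
Proof.
move=> ll lx fl; rewrite /vanish mline_affine_form.
have fd := vanish_grad ll lx fl; rewrite -/(ldir l) fd scale0r addr0.
have [s xE] : line_through (lparam l).1 (lparam l).2 x by rewrite -(lparamP ll).2.
have -> : (lparam l).1 - x = - s *: ldir l by rewrite xE opprD addNKr scaleNr.
by rewrite dotpZr fd mulr0.
Qed.

Lemma affine_form_neq0 c x : c != 0 -> affine_form c x != 0.
Proof.
move=> /row_neq0 [i ci]; apply/eqP => /(congr1 (mline x (delta_mx 0 i))).
rewrite mline_affine_form rmorph0 [dotp _ (delta_mx _ _)]dotpC dotp_delta.
move=> /(congr1 (fun q : {poly K} => q`_1)); rewrite coefD coefC coefZ coefX coef0 /=.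
by rewrite add0r mulr1; apply/eqP.
Qed.

Lemma not_divides_small f g : g != 0 -> (msize g < msize f)%N -> ~ divides f g.
Proof. by move=> g0 lt /msize_divides /(_ g0); rewrite leqNgt lt. Qed.

(** All these lines lie in the tangent plane at [x], whose equation is not divisible by [f] for
    degree reasons; Bezout with a form of degree one gives the bound. *)
Lemma lines_through_smooth_point f (M : seq (set 'rV[K]_3)) x :
  irred_elt f -> (2 < msize f)%N -> uniq M -> (forall l, l \in M -> is_line l) ->
  (forall l, l \in M -> vanish f l) -> grad f x != 0 ->
  (count (fun l => x \in l) M <= (msize f).-1)%N.
Proof.
move=> firr f2 uM lM fM gx; rewrite -size_filter.
apply: leq_trans (@bezout_sets K f (affine_form (grad f x) x) _ firr _ _ _ _ _) _.
- apply: not_divides_small; first exact: affine_form_neq0.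
  exact: leq_ltn_trans (msize_affine_form _ _) f2.
- exact: filter_uniq.
- by move=> l; rewrite mem_filter => /andP [_ /lM].
- by move=> l; rewrite mem_filter => /andP [_ /fM].
- move=> l; rewrite mem_filter => /andP [/set_mem xl lM'].
  by apply: tangent_form_vanish => //; [apply: lM|apply: fM].
rewrite -[leqRHS]muln1 leq_mul2l; apply/orP; right.
by have := msize_affine_form (grad f x) x; case: (msize _) => // -[|[]].
Qed.

End LocalGeometry.

Lemma count_split (T : Type) (P B : pred T) (s : seq T) :
  count P s = (count (fun x => P x && B x) s + count (fun x => P x && ~~ B x) s)%N.
Proof. by elim: s => //= x s ->; case: (P x); case: (B x) => /=; lia. Qed.

Section Components.
Variables (R : realFieldType) (K : fieldType).
Implicit Types (f g h : {mpoly K[3]}) (p v w c x : 'rV[K]_3) (l : set 'rV[K]_3).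
Implicit Types (Q : seq 'rV[K]_3) (M : seq (set 'rV[K]_3)) (A : R).

Lemma grad_deg1_neq0 f x : msize f = 2 -> grad f x != 0.
Proof.
move=> f2; have f0 : f != 0 by rewrite -msize_gt0 f2.
have : mdeg (mlead f) == 1%N by have := mlead_deg f0; rewrite f2 => -[->].
rewrite mdeg_eq1 => /existsP [i /eqP fi].
have fi0 : f@_U_(i) != 0 by rewrite -fi mleadc_eq0.
have s1 : (msize f^`M(i) <= 1)%N by have := msize_mderiv i f; rewrite f2.
apply/eqP => /rowP /(_ i); rewrite !mxE (msize1_polyC s1) mevalC mcoeff_deriv.
by rewrite add0m mnm0E => /eqP; rewrite (negbTE fi0).
Qed.

Lemma eval_deg1 f x (y : 'rV[K]_3) : (msize f <= 2)%N -> f.@[y 0] = f.@[x 0] + dotp (grad f x) (y - x).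
Proof.
move=> f2; have -> : y = x + 1 *: (y - x) by rewrite scale1r addrC subrK.
rewrite -mline_eval -(mline_eval0 x (y - x)) scale1r addrAC subrr add0r.
rewrite -mdir_eval -(mline_eval0 x (y - x)) mline_mdir.
have := leq_trans (size_mline x (y - x) f) f2; move: (mline _ _ _) => q q2.
have -> : q = (q`_0)%:P + (q`_1)%:P * 'X.
  apply/polyP => -[|[|i]]; rewrite coefD coefC coefCM coefX /= ?mulr0 ?addr0 ?mulr1 ?add0r //.
  by rewrite nth_default // (leq_trans q2).
by rewrite !derivE !hornerE /= addr0.
Qed.

Lemma plane_of_deg1 f x : msize f = 2 -> f.@[x 0] = 0 ->
  is_plane [set y : 'rV[K]_3 | f.@[y 0] = 0].
Proof.
move=> f2 fx; exists x, (orthogonal_plane (grad f x)).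
split; first by rewrite dim_orthogonal_plane // grad_deg1_neq0.
apply/seteqP; split=> y /=; rewrite mem_orthogonal_plane (@eval_deg1 f x y) ?f2 // fx add0r.
  by move=> ->.
by move/eqP.
Qed.

Lemma sub_zero_set f l : is_line l -> vanish f l -> (l `<=` [set y | f.@[y 0] = 0])%classic.
Proof. by move=> ll fl y ly; apply: (vanish_point ll fl). Qed.

(* Away from the zeros of a partial derivative of [f] the lines through a point lie
   in the tangent plane, so there are at most [deg f] of them. *)
Lemma smooth_component f Q M A (i : 'I_3) :
  irred_elt f -> (2 < msize f)%N -> f^`M(i) != 0 -> uniq Q -> uniq M ->
  (forall l, l \in M -> is_line l) -> (forall l, l \in M -> vanish f l) ->
  (forall l, l \in M -> A + ((msize f).-1)%:R <= (count (fun x => x \in l) Q)%:R) ->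
  0 <= A ->
  (size M)%:R * A <= ((msize f).-1)%:R * (size Q)%:R + ((msize f).-1)%:R ^+ 2 * A.
Proof.
move=> firr f2 hi0 uQ uM lM fM rich A0; set h := f^`M(i) in hi0 *.
have [f0 _ _] := firr.
set a := (msize f).-1 in rich *.
have ha : (msize h <= a)%N by apply: msize_mderiv.
have nfh : ~ divides f h.
  by apply: not_divides_small => //; apply: leq_ltn_trans ha _; rewrite /a; case: (msize f) f2.
pose M1 := [seq l <- M | vanish h l]; pose M2 := [seq l <- M | ~~ vanish h l].
have sM : size M = (size M1 + size M2)%N by rewrite !size_filter -(count_predC (vanish h) M).
have sM1 : (size M1 <= a ^ 2)%N.
  apply: leq_trans (@bezout_sets K f h M1 firr nfh _ _ _ _) _.
  - exact: filter_uniq.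
  - by move=> l; rewrite mem_filter => /andP [_ /lM].
  - by move=> l; rewrite mem_filter => /andP [_ /fM].
  - by move=> l; rewrite mem_filter => /andP [].
  by rewrite -mulnn leq_mul2l (leq_trans (leq_pred _) ha) orbT.
(* The summand [a] in [rich] pays for the zeros of [h]: each line of [M2] keeps [A] points where the
   gradient is nonzero. *)
have : (size M2)%:R * A <= a%:R * (size Q)%:R.
  apply: (@incidence_count K R M2 Q (fun x => h.@[x 0] != 0)).
    move=> l; rewrite mem_filter => /andP [hl lM'].
    have h2 := rich l lM'.
    rewrite (count_split _ (fun x => h.@[x 0] == 0)) natrD in h2.
    have h1 := zeros_on_line (lM _ lM') uQ hl; rewrite -(ler_nat R) in h1.
    have : ((msize h).-1)%:R <= a%:R :> R by rewrite ler_nat (leq_trans (leq_pred _) ha).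
    lra.
  move=> x xQ hx; apply: lines_through_smooth_point => //.
  - exact: filter_uniq.
  - by move=> l; rewrite mem_filter => /andP [_ /lM].
  - by move=> l; rewrite mem_filter => /andP [_ /fM].
  - by apply/eqP => /rowP /(_ i); rewrite !mxE; apply/eqP.
have : (size M1)%:R * A <= a%:R ^+ 2 * A by rewrite ler_wpM2r // -natrX ler_nat.
rewrite sM natrD; lra.
Qed.

End Components.

(** * Flat points in characteristic 0 *)

Lemma uniq_three (T : eqType) (s : seq T) : (2 < size s)%N -> uniq s ->
  exists x y z, [/\ x \in s, y \in s, z \in s & [/\ x <> y, x <> z & y <> z]].
Proof.
case: s => [|x [|y [|z s]]] // _; rewrite !cons_uniq !in_cons !negb_or.
move=> /and3P [/and3P [/eqP xy /eqP xz _] /andP [/eqP yz _] _].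
by exists x, y, z; rewrite !in_cons !eqxx !orbT.
Qed.

Section Flatness.
Variables (R : realFieldType) (K : fieldType).
Hypothesis char0 : [pchar K] =i pred0.
Implicit Types (f g h : {mpoly K[3]}) (p v w c x : 'rV[K]_3) (l : set 'rV[K]_3).
Implicit Types (Q : seq 'rV[K]_3) (M : seq (set 'rV[K]_3)) (A : R).

Lemma natf_neq0 n : (0 < n)%N -> n%:R != 0 :> K.
Proof. by have /pcharf0P -> := char0; rewrite lt0n. Qed.

Lemma natf_inj (m n : nat) : m%:R = n%:R :> K -> m = n.
Proof.
wlog mn : m n / (m <= n)%N => [h|].
  by case: (leqP m n) => [/h //|/ltnW/h {}h] /esym /h.
move/eqP; rewrite eq_sym -subr_eq0 -natrB //; have /pcharf0P -> := char0.
by rewrite subn_eq0 => nm; apply/eqP; rewrite eqn_leq mn nm.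
Qed.

(* If phi has order k >= 2 at 0, the left side has order k - 2: its leading coefficient is
   [beta(0) ^+ 2 * k * (k - 1)] times that of phi. *)
Lemma inflection_order (phi beta gam r : {poly K}) :
  phi != 0 -> phi.[0] = 0 -> phi^`().[0] = 0 -> beta.[0] != 0 ->
  beta ^+ 2 * phi^`()^`() - 2%:R * phi^`() * beta * beta^`() + phi^`() ^+ 2 * gam
    != r * phi.
Proof.
move=> phi0 h0 h1 b0.
have [k [psi]] := multiplicity_XsubC phi 0; rewrite phi0 polyC0 subr0 /root /= => psi0 phiE.
have psiX : (psi * 'X^k)^`() = psi^`() * 'X^k + psi * 'X^(k.-1) *+ k.
  by rewrite derivM derivXn mulrnAr.
case: k phiE psiX => [|[|n]] phiE _.
- by move: h0; rewrite phiE expr0 mulr1 => h; rewrite h eqxx in psi0.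
- move: h1; rewrite phiE expr1 derivM derivX mulr1 !hornerE ?mulr0 ?add0r => h.
  by rewrite h eqxx in psi0.
pose psi1 := psi^`() * 'X + psi *+ n.+2.
have d1 : phi^`() = psi1 * 'X^(n.+1).
  by rewrite phiE derivM derivXn /= /psi1 mulrDl -mulrA -exprS mulrnAr mulrnAl.
pose psi2 := psi1^`() * 'X + psi1 *+ n.+1.
have d2 : phi^`()^`() = psi2 * 'X^n.
  by rewrite d1 derivM derivXn /= /psi2 [RHS]mulrDl -[in RHS]mulrA -exprS mulrnAr mulrnAl.
apply/negP => /eqP; rewrite d2 d1 phiE => e.
(* Here the order is k = n + 2. After cancelling X^n, evaluation at 0 leaves beta(0)^2 psi(0) (n +
   2)(n + 1) on the left and 0 on the right. *)
have : ('X^n * (beta ^+ 2 * psi2 - 2%:R * psi1 * 'X * beta * beta^`()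
    + psi1 ^+ 2 * ('X * 'X^(n.+1)) * gam)) = 'X^n * (r * psi * 'X^2).
  have -> : 'X^n * (r * psi * 'X^2) = r * (psi * 'X^(n.+2)).
    by rewrite [_ * 'X^2]mulrC mulrA -exprD addn2; ring.
  by rewrite -e !exprS; ring.
move/(mulfI (monic_neq0 (monicXn _ n))) => /(congr1 (horner^~ 0)).
have p2 : psi2.[0] = psi.[0] *+ n.+2 *+ n.+1.
  rewrite /psi2 hornerD hornerMX mulr0 add0r hornerMn.
  by rewrite /psi1 hornerD hornerMX mulr0 add0r hornerMn.
clearbody psi1 psi2; set Z := 'X^(n.+1); clearbody Z.
rewrite !(hornerD, hornerN, hornerM, hornerXn, horner_exp, hornerX) /= p2.
rewrite !(expr0n, mulr0, mul0r, subr0, addr0) -mulrnA => /eqP.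
rewrite -[_ *+ (_ * _)]mulr_natr !mulf_eq0 (negbTE psi0) (negbTE b0) /=.
by apply/negP; exact: natf_neq0.
Qed.

(* Numerator of the second derivative of the plane section of [f = 0] in the directions
   [w, w']: the tangent direction [D_w' f w - D_w f w'] fed to the Hessian of [f]. *)
Definition flat_poly w w' f : {mpoly K[3]} :=
  mdir w' f ^+ 2 * mdir w (mdir w f)
  - 2%:R * mdir w f * mdir w' f * mdir w (mdir w' f)
  + mdir w f ^+ 2 * mdir w' (mdir w' f).

(** Restrict to the tangent line x + s w: there [f] has at least a double zero at 0, and
    [inflection_order] shows that [flat_poly] does not restrict to a multiple of it. *)
Lemma flat_poly_not_divides f x w w' :
  f.@[x 0] = 0 -> dotp (grad f x) w = 0 -> dotp (grad f x) w' != 0 ->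
  mline x w f != 0 -> ~ divides f (flat_poly w w' f).
Proof.
move=> fx gw gw' phi0 [r] /(congr1 (mline x w)).
rewrite /flat_poly rmorphD rmorphB !rmorphM rmorph_nat /= !mline_mdir.
apply/eqP; apply: inflection_order => //.
- by rewrite mline_eval0.
- by rewrite -mline_mdir mline_eval0 mdir_eval.
- by rewrite mline_eval0 mdir_eval.
Qed.

Lemma msize_mdir w f : (msize (mdir w f) <= (msize f).-1)%N.
Proof.
by apply: msize_sum_leq => i _; apply: leq_trans (msizeZ_le _ _) (msize_mderiv _ _).
Qed.

(** With a the degree of [f], each term has degree at most (a - 1) + (a - 1) + (a - 2). *)
Lemma msize_flat_poly w w' f :
  (2 < msize f)%N -> (msize (flat_poly w w' f) <= (3 * (msize f).-1 - 4).+1)%N.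
Proof.
move=> f2; have [a fa] : exists a, msize f = a.+3.
  by move: f2; case: (msize f) => [|[|[|a]]] // _; exists a.
have d1 u : (msize (mdir u f) <= a.+1.+1)%N by have := msize_mdir u f; rewrite fa.
have d2 u v : (msize (mdir u (mdir v f)) <= a.+1)%N.
  apply: leq_trans (msize_mdir _ _) _; have := d1 v.
  by case: (msize _).
have -> : (3 * (msize f).-1 - 4 = a.+1 + a.+1 + a)%N by rewrite fa; clear; lia.
have h u v y z : (msize (mdir u f * mdir v f * mdir y (mdir z f)) <= (a.+1 + a.+1 + a).+1)%N.
  by apply: msizeM_leq (d2 _ _); apply: msizeM_leq.
rewrite /flat_poly !expr2 -!mulrA [2%:R * _]mulr_natl !mulrA.
rewrite (leq_trans (msizeD_le _ _)) // geq_max h andbT.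
rewrite (leq_trans (msizeD_le _ _)) // geq_max h msizeN.
by rewrite mulr2n (leq_trans (msizeD_le _ _)) // geq_max h.
Qed.

(** The second derivatives of [f] at [x] give a binary quadratic form on the tangent plane that
    vanishes in three distinct directions, hence is zero as 2 is invertible. [flat_poly] is its
    value at a tangent vector; at a singular point this vector is 0. *)
Lemma flat_poly_triple_point f x w w' l1 l2 l3 :
  is_line l1 -> is_line l2 -> is_line l3 -> l1 x -> l2 x -> l3 x ->
  l1 <> l2 -> l1 <> l3 -> l2 <> l3 ->
  vanish f l1 -> vanish f l2 -> vanish f l3 -> (flat_poly w w' f).@[x 0] = 0.
Proof.
move=> L1 L2 L3 x1 x2 x3 /eqP n12 /eqP n13 /eqP n23 f1 f2 f3.
set c := grad f x.
pose B u v : K := (mdir u (mdir v f)).@[x 0].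
have Bl a b u v y : B (a *: u + b *: v) y = a * B u y + b * B v y.
  by rewrite /B mdir_lin mevalD !mevalZ.
have Bc u v : B u v = B v u by rewrite /B mdir_comm.
have Br a b u v y : B y (a *: u + b *: v) = a * B y u + b * B y v.
  by rewrite Bc Bl ![B _ y]Bc.
have GE : (flat_poly w w' f).@[x 0] =
    B (dotp c w' *: w + - dotp c w *: w') (dotp c w' *: w + - dotp c w *: w').
  have BE u v : (mdir u (mdir v f)).@[x 0] = B u v by [].
  rewrite /flat_poly mevalD mevalB !mevalM !BE !mdir_eval -/c.
  have -> : (2%:R : {mpoly K[3]}).@[x 0] = 2%:R by rewrite rmorph_nat.
  rewrite !(Bl, Br) [B w' w]Bc; ring.
have [c0|c0] := eqVneq c 0.
  by rewrite GE c0 !dotp0l oppr0 Bl !mul0r addr0.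
have Bd l : is_line l -> l x -> vanish f l -> B (ldir l) (ldir l) = 0.
  move=> L xl fl; rewrite /B -(mline_eval0 x (ldir l)) !mline_mdir.
  by rewrite (vanish_at L xl fl) !deriv0 horner0.
have Dd l : is_line l -> l x -> vanish f l -> dotp c (ldir l) = 0.
  by move=> L xl fl; apply: vanish_grad.
have span y : dotp c y = 0 -> exists a b : K, y = a *: ldir l1 + b *: ldir l2.
  move=> cy; apply: (@orthogonal_span K c) => //; [exact: ldir_neq0| |exact: Dd|exact: Dd].
  exact: (@ldir_nonparallel K l1 l2 x).
have [a [b e3]] := span _ (Dd _ L3 x3 f3).
have a0 : a != 0.
  apply/eqP => a0; have := @ldir_nonparallel K l2 l3 x L2 L3 x2 x3 _ b.
  by rewrite e3 a0 scale0r add0r eqxx => /(_ n23).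
have b0 : b != 0.
  apply/eqP => b0; have := @ldir_nonparallel K l1 l3 x L1 L3 x1 x3 _ a.
  by rewrite e3 b0 scale0r addr0 eqxx => /(_ n13).
(* The third direction is a d1 + b d2 with a, b nonzero, so its zero reads 2 a b B(d1, d2) = 0. *)
have B12 : B (ldir l1) (ldir l2) = 0.
  have := Bd _ L3 x3 f3; rewrite e3 Bl !Br !Bd // [B (ldir l2) _]Bc.
  rewrite !mulr0 add0r addr0 mulrCA -mulr2n -mulr_natr => /eqP.
  rewrite !mulf_eq0 (negbTE a0) (negbTE b0) (negbTE (@natf_neq0 2 isT)) orbF /=.
  by move/eqP.
have cu : dotp c (dotp c w' *: w + - dotp c w *: w') = 0.
  by rewrite dotpDr !dotpZr; ring.
have [a' [b' e]] := span _ cu.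
by rewrite GE e Bl !Br !Bd // [B (ldir l2) _]Bc B12 !(mulr0, addr0).
Qed.

Lemma mderiv_neq0_char0 f : (1 < msize f)%N -> exists i, f^`M(i) != 0.
Proof.
move=> f1; have f0 : f != 0 by rewrite -msize_gt0 (ltn_trans _ f1).
have : mlead f != 0%MM.
  by rewrite -mdeg_eq0; have := mlead_deg f0; move: f1; case: (mdeg _) => // f1 e; rewrite -e in f1.
move=> m0; have [i mi] : exists i, mlead f i != 0%N.
  apply: contrapT => h; case/eqP: m0; apply/mnmP => i; rewrite mnm0E.
  by apply/eqP/negP => /negP hi; apply: h; exists i.
exists i; apply/eqP => /(congr1 (mcoeff (mlead f - U_(i)))).
rewrite mcoeff_deriv mcoeff0 submK; last first.
  by apply/mnm_lepP => j; rewrite mnm1E; case: eqP => // <-; rewrite lt0n.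
move=> /eqP; rewrite -mulr_natr mulf_eq0 mleadc_eq0 (negbTE f0) /=.
by apply/negP; apply: natf_neq0.
Qed.

(** Some tangent line x + s (w1 + j w2) is not contained in the surface: otherwise the surface would
    share too many lines with its tangent plane. Characteristic 0 keeps the directions distinct. *)
Lemma flat_poly_exists f x i : irred_elt f -> (2 < msize f)%N ->
  f.@[x 0] = 0 -> f^`M(i).@[x 0] != 0 ->
  exists w w', ~ divides f (flat_poly w w' f).
Proof.
move=> firr f2 fx fix0; set c := grad f x.
have ci : c 0 i != 0 by rewrite mxE.
have c0 : c != 0 by apply: contra_neq ci => ->; rewrite mxE.
have [w1 [w2 [b1 [b2 [cw1 cw2 [w11 w12] [w21 w22]]]]]] := orthogonal_basis ci.
pose w (j : nat) : 'rV[K]_3 := w1 + j%:R *: w2.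
have cw j : dotp c (w j) = 0 by rewrite dotpDr dotpZr cw1 cw2 mulr0 addr0.
have [[j wj]|all0] := pselect (exists j, mline x (w j) f != 0).
  exists (w j), (delta_mx 0 i); apply: (@flat_poly_not_divides f x) => //.
  by rewrite dotpC dotp_delta.
have {}all0 j : mline x (w j) f = 0.
  by apply/eqP/negP => /negP h; apply: all0; exists j.
have sT := msize_affine_form c x.
(* Bezout is applied to [msize f] lines, one more than the degree of [f], against a form of degree
   one. *)
have : (msize f <= (msize f).-1 * (msize (affine_form c x)).-1)%N.
  apply: (@bezout_lines K f (affine_form c x) (msize f) (fun=> x) (fun j => w j)) => //.
  - apply: not_divides_small; first exact: affine_form_neq0.
    exact: leq_ltn_trans sT f2.
  - move=> j; apply/eqP => /rowP /(_ b1); rewrite !mxE w11 w21 mulr0 addr0.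
    by apply/eqP.
  - move=> j k jk /(_ 1) [t]; rewrite scale1r => /addrI e.
    have := congr1 (fun y : 'rV_3 => y 0 b1) e; rewrite !mxE w11 w21 !mulr0 !addr0 => e1.
    have t1 : t = 1 by apply: (mulIf ci); rewrite -e1 mul1r.
    have := congr1 (fun y : 'rV_3 => y 0 b2) e; rewrite !mxE w12 w22 !add0r t1 mul1r.
    by move=> /(mulIf ci) /natf_inj kj; case/eqP: jk; apply: val_inj.
  - by move=> j; rewrite mline_affine_form subrr cw scale0r addr0 -(scale0r 0) dotpZr mul0r.
have : ((msize (affine_form c x)).-1 <= 1)%N by move: sT; case: (msize _) => // -[|[]].
have [a fa] : exists a, msize f = a.+1 by exists (msize f).-1; rewrite prednK // (ltn_trans _ f2).
rewrite fa /=; case: (_.-1) => [|[|]] // _; first by rewrite muln0.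
by rewrite muln1 ltnn.
Qed.

(* A line outside [flat_poly = 0] has at most 3a - 4 points lying on three lines of the
   surface; each of its other points lies on at most two. *)
Lemma flat_component f Q M A :
  irred_elt f -> (2 < msize f)%N -> uniq Q -> uniq M ->
  (forall l, l \in M -> is_line l) -> (forall l, l \in M -> vanish f l) ->
  (forall l, l \in M -> A + ((msize f).-1)%:R <= (count (fun x => x \in l) Q)%:R) ->
  2 * ((msize f).-1)%:R <= A ->
  (size M)%:R * (A - 2 * ((msize f).-1)%:R) <=
    2 * (size Q)%:R + 3 * ((msize f).-1)%:R ^+ 2 * (A - 2 * ((msize f).-1)%:R).
Proof.
move=> firr f2 uQ uM lM fM rich Aa.
have [f0 _ _] := firr.
set a := (msize f).-1 in rich Aa *.
have a2 : (2 <= a)%N by rewrite /a; case: (msize f) f2.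
have aR : 0 <= a%:R :> R by rewrite ler0n.
have QR : 0 <= (size Q)%:R :> R by rewrite ler0n.
have [i hi0] := mderiv_neq0_char0 (ltnW f2); set h := f^`M(i) in hi0.
have ha : (msize h <= a)%N by apply: msize_mderiv.
have nfh : ~ divides f h.
  by apply: not_divides_small => //; apply: leq_ltn_trans ha _; rewrite /a; case: (msize f) f2.
have [small|big] := leqP (size M) (3 * a ^ 2).
  have : (size M)%:R * (A - 2 * a%:R) <= 3 * a%:R ^+ 2 * (A - 2 * a%:R).
    by rewrite ler_wpM2r ?subr_ge0 // -natrX -natrM ler_nat.
  lra.
(* If [h] vanished on every line, Bezout would leave at most a^2 of them, against [big]. *)
have [l lM' hl] : exists2 l, l \in M & ~~ vanish h l.
  apply: contrapT => nex; move: big; rewrite ltnNge => /negP; apply.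
  apply: leq_trans (@bezout_sets K f h M firr nfh uM lM fM _) _.
    by move=> l lM'; apply/negP => /negP hl; apply: nex; exists l.
  rewrite -mulnn mulnCA leq_mul2l; apply/orP; right.
  by rewrite (leq_trans (leq_pred _)) // (leq_trans ha) // leq_pmull.
(* The line carries at least A + a points of [Q], more than [h] has zeros on it. *)
have [x [xl hx]] : exists x, l x /\ h.@[x 0] != 0.
  apply: contrapT => nex.
  have h1 := zeros_on_line (lM _ lM') uQ hl.
  have h2 := rich _ lM'.
  suff e : count (fun x => x \in l) Q = count (fun x => (x \in l) && (h.@[x 0] == 0)) Q.
    rewrite -e -(ler_nat R) in h1.
    have : ((msize h).-1)%:R <= a%:R - 1 :> R.
      by rewrite lerBrDr natr1 ler_nat prednK // msize_gt0.
    lra.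
  apply: eq_count => x /=; case xl: (x \in l) => //=; apply/esym/eqP.
  by apply: contrapT => /eqP hx; apply: nex; exists x; split=> //; apply: set_mem.
have fx := vanish_point (lM _ lM') (fM _ lM') xl.
have [w [w' nfG]] := flat_poly_exists firr f2 fx hx.
set G := flat_poly w w' f in nfG.
have sG : ((msize G).-1 <= 3 * a - 4)%N.
  by have := msize_flat_poly w w' f2; rewrite -/G -/a; case: (msize G).
pose M1 := [seq l <- M | vanish G l]; pose M2 := [seq l <- M | ~~ vanish G l].
have sM : size M = (size M1 + size M2)%N by rewrite !size_filter -(count_predC (vanish G) M).
have sM1 : (size M1 <= 3 * a ^ 2)%N.
  apply: leq_trans (@bezout_sets K f G M1 firr nfG _ _ _ _) _.
  - exact: filter_uniq.
  - by move=> k; rewrite mem_filter => /andP [_ /lM].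
  - by move=> k; rewrite mem_filter => /andP [_ /fM].
  - by move=> k; rewrite mem_filter => /andP [].
  rewrite -mulnn mulnCA leq_mul2l; apply/orP; right.
  by rewrite (leq_trans sG) // leq_subr.
(* Removing the at most 3a - 4 zeros of [G] from at least A + a points leaves A - 2a; by
   [flat_poly_triple_point] none of those left lies on three lines of [M2]. *)
have : (size M2)%:R * (A - 2 * a%:R) <= 2%:R * (size Q)%:R.
  apply: (@incidence_count K R M2 Q (fun x => G.@[x 0] != 0)).
    move=> k; rewrite mem_filter => /andP [Gk kM].
    have h2 := rich k kM.
    rewrite (count_split _ (fun x => G.@[x 0] == 0)) natrD in h2.
    have h1 := leq_trans (zeros_on_line (lM _ kM) uQ Gk) sG; rewrite -(ler_nat R) in h1.
    have : (3 * a - 4)%:R <= 3 * a%:R :> R by rewrite -natrM ler_nat leq_subr.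
    lra.
  move=> y yQ Gy; rewrite -size_filter.
  rewrite leqNgt; apply/negP => /uniq_three [|l1 [l2 [l3 [m1 m2 m3 [n12 n13 n23]]]]].
    by rewrite !filter_uniq.
  have hk k : k \in [seq k <- M2 | y \in k] -> [/\ is_line k, k y & vanish f k].
    rewrite !mem_filter => /and3P [/set_mem ky _ kM].
    by split=> //; [apply: lM|apply: fM].
  case/negP: Gy; apply/eqP.
  have [L1 x1 f1] := hk l1 m1; have [L2 x2 f2'] := hk l2 m2; have [L3 x3 f3] := hk l3 m3.
  exact: (@flat_poly_triple_point f y w w' l1 l2 l3).
have : (size M1)%:R * (A - 2 * a%:R) <= 3 * a%:R ^+ 2 * (A - 2 * a%:R).
  by rewrite ler_wpM2r ?subr_ge0 // -natrX -natrM ler_nat.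
have aux (X Y Z V W : R) : Z <= V -> Y <= W -> X = Y + Z -> X <= V + W by lra.
by move=> h1 h2; apply: (aux _ _ _ _ _ h2 h1); rewrite -mulrDl -natrD -sM.
Qed.

End Flatness.

(** * Surfaces of minimal degree *)

Section Frobenius.
Variables (K : fieldType) (p : nat).
Hypothesis charKp : p \in [pchar K].
Implicit Types (f g : {mpoly K[3]}) (x : 'rV[K]_3).

(** The i-th derivative carries the coefficient k_i f_k, so every exponent of every monomial of [f]
    is a multiple of [p]. *)
Lemma mpoly_pth_exponents f : (forall i, f^`M(i) = 0) -> (0 < msize f)%N ->
  f = \sum_(m : 'X_{1..3 < ((msize f).-1 %/ p).+1}) f@_(m *+ p)%MM *: 'X_[(m *+ p)%MM].
Proof.
move=> df f0; have p0 : (0 < p)%N := prime_gt0 (pcharf_prime charKp).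
have dvd_exp k i : f@_k != 0 -> (p %| k i)%N.
  move=> fk; case ki : (k i) => [|e]; first exact: dvdn0.
  have := congr1 (mcoeff (k - U_(i))) (df i); rewrite mcoeff_deriv mcoeff0 submK; last first.
    by apply/mnm_lepP => j; rewrite mnm1E; case: eqP => // <-; rewrite ki.
  rewrite mnmBE mnm1E eqxx ki subn1 /= => /eqP.
  by rewrite -mulr_natr mulf_eq0 (negbTE fk) /= -(dvdn_pcharf charKp).
apply/mpolyP => k; rewrite raddf_sum /=.
under eq_bigr do rewrite mcoeffZ mcoeffX.
have [fk0|fk] := eqVneq f@_k 0.
  rewrite fk0 big1 // => m _; case: eqP => [->|]; last by rewrite mulr0.
  by rewrite fk0 mul0r.
pose m0 : 'X_{1..3} := [multinom k i %/ p | i < 3]%N.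
have m0k : (m0 *+ p)%MM = k.
  by apply/mnmP => i; rewrite mulmnE mnmE divnK // dvd_exp.
have m0lt : (mdeg m0 < ((msize f).-1 %/ p).+1)%N.
  rewrite ltnS leq_divRL // -mdegMn m0k -ltnS prednK //.
  by apply: msize_mdeg_lt; rewrite mcoeff_msupp.
rewrite (bigD1 (BMultinom m0lt)) //= m0k eqxx mulr1 big1 ?addr0 // => m mm0.
case: eqP => [e|]; last by rewrite mulr0.
case/eqP: mm0; apply/val_inj/mnmP => i /=.
have := congr1 (fun k : 'X_{1..3} => k i) (etrans e (esym m0k)).
by rewrite !mulmnE => /eqP; rewrite eqn_pmul2r // => /eqP.
Qed.

(* If no polynomial of degree [deg f / p] vanished on [Q], the evaluation matrix of the
   monomials of that degree would have full rank, and so would its Frobenius twist; but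
   [f], being a polynomial in the p-th powers of the variables, is in the kernel of the twist. *)
Lemma frobenius_descent f (Q : seq 'rV[K]_3) :
  (1 < msize f)%N -> (forall i, f^`M(i) = 0) -> (forall x, x \in Q -> f.@[x 0] = 0) ->
  exists g, [/\ g != 0, (msize g < msize f)%N & forall x, x \in Q -> g.@[x 0] = 0].
Proof.
move=> f1 df fQ; have pp := pcharf_prime charKp.
set e := ((msize f).-1 %/ p).+1.
have elt : (e < msize f)%N.
  rewrite /e -[ltnRHS]prednK ?(ltn_trans _ f1) // ltnS ltn_Pdiv ?prime_gt1 //.
  by move: f1; case: (msize f).
pose ev (m : 'X_{1..3 < e}) (j : 'I_(size Q)) : K :=
  \prod_i (tnth (in_tuple Q) j) 0 i ^+ m i.
pose B : 'M[K]_(#|{: 'X_{1..3 < e}}|, size Q) := \matrix_(r, j) ev (enum_val r) j.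
have [freeB|] := boolP (row_free B).
  (* Applying a field morphism entrywise preserves rank; this avoids p-th roots of the coefficients
     of [f], which may not lie in [K]. *)
  have freeF : row_free (map_mx (pFrobenius_aut charKp) B).
    by rewrite /row_free mxrank_map.
  (* Frobenius turns the value of the monomial m at a point into that of its p-th power, so pairing
     these coefficients with a column of the twist evaluates [f] there. *)
  pose u : 'rV[K]_(#|{: 'X_{1..3 < e}}|) := \row_r f@_(val (enum_val r) *+ p)%MM.
  have uB : u *m map_mx (pFrobenius_aut charKp) B = 0.
    apply/rowP => j; rewrite !mxE.
    have xQ : tnth (in_tuple Q) j \in Q by apply: mem_tnth.
    apply: etrans (fQ _ xQ); rewrite [in RHS](mpoly_pth_exponents df (ltnW f1)) raddf_sum /=.
    rewrite [RHS](reindex (@enum_val _ (mem {: 'X_{1..3 < e}}))) /=; last first.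
      by apply: onW_bij; apply: enum_val_bij.
    apply: eq_bigr => r _; rewrite !mxE mevalZ mevalX pFrobenius_autE /ev -prodrXl.
    by congr (_ * _); apply: eq_bigr => i _; rewrite mulmnE exprM.
  have u0 : u = 0 by apply: (row_free_inj freeF); rewrite uB mul0mx.
  have f0 : f = 0.
    rewrite (mpoly_pth_exponents df (ltnW f1)) big1 // => m _.
    have := congr1 (fun v : 'rV_ _ => v 0 (enum_rank m)) u0.
    by rewrite !mxE enum_rankK => ->; rewrite scale0r.
  by rewrite f0 msize0 in f1.
rewrite -kermx_eq0 => /rowV0Pn [u /sub_kermxP uB u0].
pose g := mpoly_of ([ffun m : 'X_{1..3 < e} => u 0 (enum_rank m)] : mspace K e).
exists g; split.
- apply: contra_neq u0 => g0; have : mspace_of e g = 0 by rewrite g0 linear0.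
  rewrite mpoly_ofK => /ffunP h; apply/rowP => r.
  by have := h (enum_val r); rewrite !ffunE enum_valK mxE.
- exact: leq_ltn_trans (msize_mpoly_of _) elt.
move=> x /seq_tnthP [j ->].
have := congr1 (fun v : 'rV_(size Q) => v 0 j) uB; rewrite !mxE => <-.
rewrite /g /mpoly_of raddf_sum /= (reindex (@enum_val _ (mem {: 'X_{1..3 < e}}))) /=; last first.
  by apply: onW_bij; apply: enum_val_bij.
by apply: eq_bigr => r _; rewrite !mxE mevalZ mevalX ffunE enum_valK.
Qed.

End Frobenius.

Section MinimalSurface.
Variable K : fieldType.
Implicit Types (f g h F : {mpoly K[3]}) (x : 'rV[K]_3) (l : set 'rV[K]_3).
Implicit Types (P : seq 'rV[K]_3) (fs : seq {mpoly K[3]}).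

Lemma exists_vanishing_small P (e : nat) : (size P < 'C(e.+2, 3))%N ->
  exists g, [/\ g != 0, (msize g <= e)%N & forall x, x \in P -> g.@[x 0] = 0].
Proof.
move=> lt; apply: contrapT => nex.
move: lt; rewrite ltnNge -(dim_mspace K) => /negP; apply.
suff: (dim (mspace K e) <= dim (mspace K 0) + dim 'rV[K]_(size P))%N.
  by rewrite dim_rV (dim_mspace K 0).
pose b (u : mspace K e) : 'rV[K]_(size P) := \row_i (mpoly_of u).@[(tnth (in_tuple P) i) 0].
apply: (@dim_le_ker_image K _ _ _ (fun=> 0) b).
- by move=> c u w; rewrite scaler0 addr0.
- by move=> c u w; apply/rowP => i; rewrite !mxE linearP mevalD mevalZ.
move=> u bu; exists 0; apply: contrapT => u0; apply: nex; exists (mpoly_of u).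
split; [|exact: msize_mpoly_of|].
  by apply/eqP => h; apply: u0; rewrite -(mpoly_ofK u) h linear0.
move=> x /seq_tnthP [i ->].
by have := congr1 (fun r : 'rV_(size P) => r 0 i) bu; rewrite !mxE.
Qed.

(** The binomial bound says that the dimension count yields no vanishing polynomial of degree
    smaller than that of [F]. *)
Lemma minimal_vanishing P : exists F, [/\ F != 0, forall x, x \in P -> F.@[x 0] = 0,
    forall g, g != 0 -> (forall x, x \in P -> g.@[x 0] = 0) -> (msize F <= msize g)%N &
    ('C((msize F).-1.+2, 3) <= size P)%N].
Proof.
have : exists n, `[< exists2 g, g != 0 /\ (forall x, x \in P -> g.@[x 0] = 0) & msize g = n >].
  have [|g [g0 _ gP]] := @exists_vanishing_small P (size P).+1.
    move: (binomial3 (size P).+1); move: 'C(_, _) => c; nia.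
  by exists (msize g); apply/asboolP; exists g.
case/ex_minnP => n /asboolP [F [F0 FP] sF] Fmin; exists F; split=> //.
  by move=> g g0 gP; rewrite sF; apply: Fmin; apply/asboolP; exists g.
rewrite leqNgt; apply/negP => /exists_vanishing_small [g [g0 sg gP]].
have : (n <= msize g)%N by apply: Fmin; apply/asboolP; exists g.
by rewrite leqNgt -sF (leq_ltn_trans sg) // prednK // msize_gt0.
Qed.

Lemma irred_factorization F : F != 0 -> exists (c : K) fs,
  [/\ c != 0, forall f, f \in fs -> irred_elt f & F = c%:MP * \prod_(f <- fs) f].
Proof.
have [n] := ubnP (msize F); elim: n F => // n IH F; rewrite ltnS => hn F0.
have small_unit h : h != 0 -> (msize h <= 1)%N -> h \is a GRing.unit.
  move=> h0 /msize1_polyC hE; rewrite hE rmorph_unit // unitfE.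
  by apply: contra_neq h0 => c0; rewrite hE c0 mpolyC0.
have [s1|s1] := leqP (msize F) 1.
  exists F@_0, [::]; rewrite big_nil mulr1; have FE := msize1_polyC s1.
  by split=> //; apply: contra_neq F0 => c0; rewrite FE c0 mpolyC0.
have FU : F \isn't a GRing.unit.
  apply/negP => /mulVr /(congr1 (fun h => msize h)).
  have [V0|V0] := eqVneq F^-1 0; first by rewrite V0 mul0r msize0 msize1.
  rewrite msizeM_irred // msize1; have : (0 < msize F^-1)%N by rewrite msize_gt0.
  have aux i j : (1 < i -> 0 < j -> j + i.-1 = 1 -> False)%N by lia.
  exact: aux.
have [irr|nirr] := pselect (irred_elt F).
  exists 1, [:: F]; rewrite oner_eq0 big_seq1 mpolyC1 mul1r; split=> // f.
  by rewrite inE => /eqP ->.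
have [b [c [Fbc bU cU]]] : exists b c, [/\ F = b * c, b \isn't a GRing.unit & c \isn't a GRing.unit].
  apply: contrapT => h; apply: nirr; split=> // b c Fbc.
  apply: contrapT => /not_orP [/negP bU /negP cU]; apply: h; exists b, c; by split.
have b0 : b != 0 by apply: contra_neq F0 => b0; rewrite Fbc b0 mul0r.
have c0 : c != 0 by apply: contra_neq F0 => c0; rewrite Fbc c0 mulr0.
have sb : (1 < msize b)%N by rewrite ltnNge; apply: contraNN bU => /small_unit ->.
have sc : (1 < msize c)%N by rewrite ltnNge; apply: contraNN cU => /small_unit ->.
have sF : msize F = (msize b + (msize c).-1)%N by rewrite Fbc msizeM_irred.
have aux i j : (1 < i -> 1 < j -> i < i + j.-1 /\ j < i + j.-1)%N by lia.
have [lb lc] := aux _ _ sb sc; rewrite -sF in lb lc.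
have [||cb [fb [cb0 ib eb]]] := IH b => //; first exact: leq_trans lb hn.
have [||cc [fc [cc0 ic ec]]] := IH c => //; first exact: leq_trans lc hn.
exists (cb * cc), (fb ++ fc); split; first by rewrite mulf_neq0.
  by move=> f; rewrite mem_cat => /orP [/ib|/ic].
by rewrite Fbc eb ec big_cat /= mpolyCM; ring.
Qed.

Lemma degM f g : f != 0 -> g != 0 -> (msize (f * g)).-1 = ((msize f).-1 + (msize g).-1)%N.
Proof.
move=> f0 g0; rewrite msizeM_irred //; have : (0 < msize f)%N by rewrite msize_gt0.
by case: (msize f).
Qed.

Lemma deg_prod fs : (forall f, f \in fs -> f != 0) ->
  (msize (\prod_(f <- fs) f)).-1 = (\sum_(f <- fs) (msize f).-1)%N.
Proof.
elim: fs => [|f fs IH] fs0; first by rewrite !big_nil msize1.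
rewrite !big_cons degM ?IH //.
- by move=> g gfs; apply: fs0; rewrite inE gfs orbT.
- by apply: fs0; rewrite inE eqxx.
- by rewrite prodf_seq_neq0; apply/allP => g gfs; apply: fs0; rewrite inE gfs orbT.
Qed.

End MinimalSurface.

(** * Distribution of lines and points among the irreducible factors *)

Lemma sum_count_eq (T : Type) (s : seq T) (g : T -> nat) (k : nat) :
  all (fun x => g x < k)%N s -> (\sum_(i < k) count (fun x => g x == i) s)%N = size s.
Proof.
elim: s => [|x s IH] /=; first by rewrite big1.
case/andP => gx /IH {}IH; rewrite big_split /= IH (bigD1 (Ordinal gx)) //= eqxx.
rewrite big1 // => i /eqP ni; case: (g x =P i) => // e.
by case: ni; apply: val_inj.
Qed.

Lemma find_first (T : Type) (P : pred T) (x0 : T) (s : seq T) (i : nat) :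
  (i < size s)%N -> ~~ has P (take i s) -> P (nth x0 s i) -> find P s = i.
Proof.
move=> hi hn hp; rewrite -(cat_take_drop i s) find_cat (negbTE hn).
by rewrite (drop_nth x0) //= hp size_takel ?addn0 // ltnW.
Qed.

Section Decomposition.
Variables (R : realFieldType) (K : fieldType).
Implicit Types (f g : {mpoly K[3]}) (x : 'rV[K]_3) (l : set 'rV[K]_3).

Definition degree_minimal f (Q : seq 'rV[K]_3) : Prop :=
  forall g, g != 0 -> (forall x, x \in Q -> g.@[x 0] = 0) -> (msize f <= msize g)%N.

Variables (L : seq (set 'rV[K]_3)) (P : seq 'rV[K]_3) (N be : R).
Hypotheses (uL : uniq L) (uP : uniq P) (lineL : forall l, l \in L -> is_line l).
Hypothesis rich : forall l, l \in L -> N <= (count (fun x => x \in l) P)%:R.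
Hypothesis N0 : 0 < N.
Hypothesis few : 50 * (size P)%:R < N ^+ 3.
(** Bound for a single factor, linear in its degree and its number of points so that it can be
    summed; [be] depends on the characteristic. *)
Hypothesis component : forall f (Q : seq 'rV[K]_3) (M : seq (set 'rV[K]_3)) (A : R),
  irred_elt f -> degree_minimal f Q -> (forall x, x \in Q -> f.@[x 0] = 0) ->
  uniq Q -> uniq M -> (size Q <= size P)%N -> {subset M <= L} -> (forall l, l \in M -> vanish f l) ->
  (forall l, l \in M -> A + ((msize f).-1)%:R <= (count (fun x => x \in l) Q)%:R) ->
  N / 2 <= A ->
  (size M)%:R <= N / 4 * ((msize f).-1)%:R + be * (size Q)%:R.

(* Each line and each point is assigned to the first factor in [fs] vanishing on it, so that
   a line assigned to the i-th factor loses at most [deg (\prod_(j < i) f_j)] of its points. *)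
Lemma lines_le : (size L)%:R <= N ^+ 2 / 8 + be * (size P)%:R.
Proof.
have [F [F0 FP Fmin FD]] := minimal_vanishing P.
have [c [fs [c0 irr FE]]] := irred_factorization F0.
set d := (msize F).-1 in FD.
have fs0 f : f \in fs -> f != 0 by move=> /irr [].
have dE : d = (\sum_(f <- fs) (msize f).-1)%N.
  rewrite /d FE degM ?mpolyC_eq0 //; last by rewrite prodf_seq_neq0; apply/allP.
  by rewrite msizeC c0 deg_prod.
(* The dimension count gives d^3 <= 6 |P|. With N <= 2d this would yield N^3 <= 48 |P|, against
   [few]. *)
have dN : 2 * d%:R < N.
  have h : (d ^ 3 <= 6 * size P)%N.
    move: FD (binomial3 d); move: 'C(_, _) => D h1 h2; rewrite !expnS expn0 muln1; nia.
  rewrite ltNge; apply/negP => h2.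
  have h3 : N ^+ 3 <= (2 * d%:R) ^+ 3 
    by rewrite ler_pXn2r // nnegrE; [exact: ltW|exact: le_trans (ltW N0) h2].
  have h4 : d%:R ^+ 3 <= 6 * (size P)%:R :> R by rewrite -natrX -natrM ler_nat.
  have h5 : (2 * d%:R) ^+ 3 = 8 * d%:R ^+ 3 :> R by ring.
  have h6 : 0 <= (size P)%:R :> R by rewrite ler0n.
  have aux (u y z : R) : 50 * u < y -> y <= 8 * z -> z <= 6 * u -> 0 <= u -> False by lra.
  by rewrite h5 in h3; apply: aux few h3 h4 h6.
pose pidx x := find (fun f => f.@[x 0] == 0) fs.
pose lidx l := find (fun f => vanish f l) fs.
pose k := size fs.
have pidx_lt x : x \in P -> (pidx x < k)%N.
  move=> /FP; rewrite FE mevalM mevalC => /eqP; rewrite mulf_eq0 (negbTE c0) /=.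
  by rewrite rmorph_prod /= prodf_seq_eq0 -has_find.
have lidx_lt l : l \in L -> (lidx l < k)%N.
  move=> lL; rewrite -has_find -vanish_prod.
  have : vanish F l.
    apply: (@vanish_of_roots _ _ _ [seq x <- P | x \in l] (lineL lL)).
    - exact: filter_uniq.
    - by move=> x; rewrite mem_filter => /andP [/set_mem xl /FP].
    rewrite size_filter -(prednK (_ : 0 < msize F)%N) ?msize_gt0 // -/d.
    rewrite -(ltr_nat R); apply: lt_le_trans (rich lL).
    have d0 : 0 <= d%:R :> R by rewrite ler0n.
    have aux (u y : R) : 2 * u < y -> 0 <= u -> u < y by lra.
    exact: aux dN d0.
  by rewrite FE vanishM /vanish mlineC polyC_eq0 (negbTE c0).
pose Q i := [seq x <- P | pidx x == i]; pose M i := [seq l <- L | lidx l == i].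
pose fi i := nth 0 fs i.
have comp (i : 'I_k) : (size (M i))%:R <= N / 4 * ((msize (fi i)).-1)%:R + be * (size (Q i))%:R.
  have ik := ltn_ord i; have fifs : fi i \in fs by rewrite mem_nth.
  have split_fs : fs = take i fs ++ fi i :: drop i.+1 fs.
    by rewrite -drop_nth // cat_take_drop.
  have dsplit : d = (\sum_(f <- take i fs) (msize f).-1 + ((msize (fi i)).-1 +
      \sum_(f <- drop i.+1 fs) (msize f).-1))%N.
    by rewrite dE {1}split_fs big_cat big_cons.
  have take0 f : f \in take i fs -> f != 0 by move=> /mem_take /fs0.
  have drop0 f : f \in drop i.+1 fs -> f != 0 by move=> /mem_drop /fs0.
  apply: (@component (fi i) (Q i) (M i) (N - d%:R)).
  - exact: irr.
  (* Minimality passes from [F] to its factor: exchanging [fi i] for [g] keeps the product zero on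
     [P], since a point of another index is a zero of another factor. *)
  - move=> g g0 gQ.
    pose F' := \prod_(f <- take i fs) f * (g * \prod_(f <- drop i.+1 fs) f).
    have T0 : \prod_(f <- take i fs) f != 0 by rewrite prodf_seq_neq0; apply/allP.
    have D0 : \prod_(f <- drop i.+1 fs) f != 0 by rewrite prodf_seq_neq0; apply/allP.
    have F'0 : F' != 0 by rewrite !mulf_neq0.
    have F'P x : x \in P -> F'.@[x 0] = 0.
      move=> xP; have jk := pidx_lt x xP.
      have : has (fun f => f.@[x 0] == 0) fs by rewrite has_find.
      have [e|ne] := eqVneq (pidx x) i.
        by move=> _; rewrite !mevalM gQ ?mul0r ?mulr0 // mem_filter e eqxx.
      move=> hx; have := nth_find 0 hx; rewrite -/(pidx x) => /eqP fx.
      have : nth 0 fs (pidx x) \in take i fs ++ drop i.+1 fs.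
        case: (ltngtP (pidx x) i) ne => // lt _; rewrite mem_cat.
          by rewrite -(nth_take _ lt) mem_nth // size_takel // ltnW.
        apply/orP; right; rewrite -(subnKC lt) -nth_drop mem_nth //.
        by rewrite size_drop ltn_sub2r // (leq_trans _ jk).
      rewrite mem_cat => /orP [] h; rewrite !mevalM !rmorph_prod /=.
        by rewrite (big_rem _ h) /= fx !mul0r.
      by rewrite [X in _ * (_ * X)](big_rem _ h) /= fx mul0r !mulr0.
    have : (d <= (msize F').-1)%N by rewrite /d -!subn1 leq_sub2r // Fmin.
    rewrite !degM ?mulf_neq0 // !deg_prod // dsplit leq_add2l leq_add2r.
    have : (0 < msize (fi i))%N by rewrite msize_gt0 fs0.
    have : (0 < msize g)%N by rewrite msize_gt0.
    have aux a b : (0 < a -> 0 < b -> b.-1 <= a.-1 -> b <= a)%N by lia.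
    exact: aux.
  - move=> x; rewrite mem_filter => /andP [/eqP e xP].
    have hx : has (fun f => f.@[x 0] == 0) fs by rewrite has_find pidx_lt.
    by have := nth_find 0 hx; rewrite -/(pidx x) e => /eqP.
  - exact: filter_uniq.
  - exact: filter_uniq.
  - by rewrite size_filter count_size.
  - by move=> l; rewrite mem_filter => /andP [].
  - move=> l; rewrite mem_filter => /andP [/eqP e lL].
    have hl : has (fun f => vanish f l) fs by rewrite has_find lidx_lt.
    by have := nth_find 0 hl; rewrite -/(lidx l) e.
  - move=> l; rewrite mem_filter => /andP [/eqP li lL].
    have hl : has (fun f => vanish f l) fs by rewrite has_find lidx_lt.
    have fil : vanish (fi i) l by have := nth_find 0 hl; rewrite -/(lidx l) li.
    (* Points of [l] with a smaller index are zeros of [h], which is nonzero on [l]; the remaining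
       points of [l] have index exactly [i] because [fi i] vanishes on [l]. *)
    pose h := \prod_(f <- take i fs) f.
    have nh : ~~ vanish h l.
      rewrite vanish_prod; apply/negP => /(hasP) [f ft fl].
      have ti : size (take i fs) = i by rewrite size_takel // ltnW.
      have := @before_find _ 0 (fun f => vanish f l) fs (index f (take i fs)).
      rewrite -/(lidx l) li -[X in (_ < X)%N]ti index_mem ft => /(_ isT).
      by rewrite -(@nth_take i) ?nth_index ?fl // -[X in (_ < X)%N]ti index_mem.
    have h1 := zeros_on_line (lineL lL) uP nh.
    rewrite deg_prod // in h1.
    have h2 := rich lL; rewrite (count_split _ (fun x => h.@[x 0] == 0)) natrD in h2.
    have h3 : (count (fun x => (x \in l) && (h.@[x 0] != 0)%R) P <= count (fun x => x \in l) (Q i))%N.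
      rewrite count_filter; apply: sub_count => x /= /andP [xl hx].
      rewrite xl /=; apply/eqP; apply: find_first (ik) _ _; last first.
        by apply/eqP; apply: (vanish_point (lineL lL) fil); apply: set_mem.
      apply: contraNN hx => hx; rewrite rmorph_prod /= prodf_seq_eq0.
      exact: hx.
    rewrite -(ler_nat R) in h3; rewrite -(ler_nat R) in h1.
    have h4 : (\sum_(f <- take i fs) (msize f).-1)%:R + ((msize (fi i)).-1)%:R <= d%:R :> R.
      by rewrite -natrD ler_nat dsplit addnA leq_addr.
    have aux (n n1 n2 n3 s a u : R) : n1 <= s -> n <= n1 + n2 -> n2 <= n3 -> s + a <= u ->
      n - u + a <= n3 by lra.
    exact: aux h1 h2 h3 h4.
  - have aux (u y : R) : 2 * u < y -> y / 2 <= y - u by lra.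
    exact: aux dN.
have -> : size L = (\sum_(i < k) size (M i))%N.
  rewrite -(@sum_count_eq _ L lidx k); last by apply/allP => l /lidx_lt.
  by apply: eq_bigr => i _; rewrite size_filter.
have -> : size P = (\sum_(i < k) size (Q i))%N.
  rewrite -(@sum_count_eq _ P pidx k); last by apply/allP => x /pidx_lt.
  by apply: eq_bigr => i _; rewrite size_filter.
have dk : d%:R = \sum_(i < k) ((msize (fi i)).-1)%:R :> R.
  by rewrite dE (big_nth 0) big_mkord natr_sum.
apply: (@le_trans _ _ (N / 4 * d%:R + be * (\sum_(i < k) size (Q i))%N%:R)).
  rewrite dk !natr_sum !mulr_sumr -big_split; apply: ler_sum => i _; exact: comp.
rewrite lerD2r; have d0 : 0 <= d%:R :> R by rewrite ler0n.
have aux (u y : R) : 0 < y -> 2 * u < y -> 0 <= u -> y / 4 * u <= y ^+ 2 / 8 by nra.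
exact: aux N0 dN d0.
Qed.

End Decomposition.

(** * Counting *)

Section CountingArithmetic.
Variable R : realFieldType.

(** From a N^2 <= 8n < (8/50) N^3. *)
Lemma small_degree (N a q n : R) : 0 < N -> q <= n -> 50 * n < N ^+ 3 ->
  a * N ^+ 2 <= 8 * q -> 25 * a <= 4 * N.
Proof.
move=> N0 qn few h; have N2 : 0 < N ^+ 2 by rewrite exprn_gt0.
rewrite -(ler_pM2r N2) -!mulrA -exprS; lra.
Qed.

Lemma small_twice (N A a : R) : 0 < N -> N / 2 <= A -> 25 * a <= 4 * N -> 2 * a <= A.
Proof. lra. Qed.

(** Since A - 2a >= 9N/50, the incidence term is at most (100/9) q/N; since N a^2 <= (32/25) q, the
    term 3a^2 is below 4 q/N. Together they stay under 16 q/N. *)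
Lemma flat_count (N A a q s : R) : 0 < N -> N / 2 <= A -> 0 <= a -> 0 <= q ->
  a * N ^+ 2 <= 8 * q -> 25 * a <= 4 * N ->
  s * (A - 2 * a) <= 2 * q + 3 * a ^+ 2 * (A - 2 * a) -> s <= 16 / N * q.
Proof.
move=> N0 NA a0 q0 ha aN h.
have D : 9 / 50 * N <= A - 2 * a by lra.
have D0 : 0 < A - 2 * a by lra.
rewrite -(ler_pM2l N0).
have -> : N * (16 / N * q) = 16 * q by field; rewrite gt_eqF.
have h1 : (s - 3 * a ^+ 2) * (A - 2 * a) <= 2 * q by lra.
have h2 : 9 / 50 * N * (s - 3 * a ^+ 2) <= 2 * q.
  have [neg|pos] := ltP (s - 3 * a ^+ 2) 0; first by nra.
  by apply: le_trans h1; rewrite mulrC ler_wpM2l.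
have h3 : 25 * (N * a ^+ 2) <= 4 * (8 * q).
  apply: (@le_trans _ _ (4 * (a * N ^+ 2))); last by lra.
  have : 25 * a * (N * a) <= 4 * N * (N * a) by rewrite ler_wpM2r // mulr_ge0 // ltW.
  have -> : 25 * a * (N * a) = 25 * (N * a ^+ 2) by ring.
  by have -> : 4 * N * (N * a) = 4 * (a * N ^+ 2) by ring.
lra.
Qed.

(** s <= a^2 + 2 a q/N. Here a <= N and a N^2 <= 8q give a^2 <= 8 q/N, and a N^2 <= 8n turns the
    other term into 16 n q/N^3. *)
Lemma smooth_count (N A a q n s : R) : 0 < N -> N / 2 <= A -> 0 <= a -> 0 <= q ->
  q <= n -> 50 * n < N ^+ 3 -> a * N ^+ 2 <= 8 * q ->
  s * A <= a * q + a ^+ 2 * A -> s <= (8 / N + 16 * n / N ^+ 3) * q.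
Proof.
move=> N0 NA a0 q0 qp few ha h.
have N3 : 0 < N ^+ 3 by rewrite exprn_gt0.
have N2 : 0 < N ^+ 2 by rewrite exprn_gt0.
have Ap : 0 < A by apply: lt_le_trans NA; rewrite divr_gt0.
have h1 : (s - a ^+ 2) * A <= a * q by lra.
have h2 : N * (s - a ^+ 2) <= 2 * (a * q).
  have [neg|pos] := ltP (s - a ^+ 2) 0.
    apply: (@le_trans _ _ 0); last by rewrite !mulr_ge0.
    by rewrite pmulr_rle0 // ltW.
  have : (s - a ^+ 2) * (N / 2) <= (s - a ^+ 2) * A by rewrite ler_wpM2l.
  lra.
have an : a * N ^+ 2 <= 8 * n by lra.
have N3E : N ^+ 3 = N * N ^+ 2 by ring.
rewrite -(ler_pM2l N3).
have -> : N ^+ 3 * ((8 / N + 16 * n / N ^+ 3) * q) = 8 * (N ^+ 2 * q) + 16 * (n * q).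
  by field; rewrite gt_eqF.
have h3 : N ^+ 2 * (N * (s - a ^+ 2)) <= N ^+ 2 * (2 * (a * q)) by rewrite ler_wpM2l // ltW.
have h4 : 2 * q * (a * N ^+ 2) <= 2 * q * (8 * n) by rewrite ler_wpM2l // mulr_ge0.
have h5 : a * N * (a * N ^+ 2) <= a * N * (8 * q) by rewrite ler_wpM2l // mulr_ge0 // ltW.
have aN : a <= N.
  rewrite -(ler_pM2r N2) -N3E; apply: (le_trans an); lra.
have h6 : 8 * q * N * a <= 8 * q * N * N by rewrite ler_wpM2l // !mulr_ge0 // ltW.
have -> : N ^+ 3 * s = N ^+ 2 * (N * (s - a ^+ 2)) + a * N * (a * N ^+ 2) by ring.
have -> : N ^+ 2 * q = q * N * N by ring.
lra.
Qed.

End CountingArithmetic.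

Section ComponentBounds.
Variables (R : realFieldType) (K : fieldType).
Implicit Types (f g : {mpoly K[3]}) (x : 'rV[K]_3) (l : set 'rV[K]_3).
Definition planar_bound (L : seq (set 'rV[K]_3)) (N : R) : Prop :=
  forall (H : set 'rV[K]_3) (M : seq (set 'rV[K]_3)), is_plane H -> uniq M ->
    {subset M <= L} -> (forall l, l \in M -> (l `<=` H)%classic) -> (size M)%:R <= N.

(** Settles all cases independent of the characteristic; the hypothesis on nonplanar factors with a
    N^2 <= 8q is left to the two specialisations. *)
Lemma component_bound (L : seq (set 'rV[K]_3)) (N A be : R)
    f (Q : seq 'rV[K]_3) (M : seq (set 'rV[K]_3)) :
  (forall l, l \in L -> is_line l) -> 0 < N -> planar_bound L N ->
  irred_elt f -> degree_minimal f Q -> uniq Q -> uniq M ->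
  {subset M <= L} -> (forall l, l \in M -> vanish f l) ->
  (forall l, l \in M -> A + ((msize f).-1)%:R <= (count (fun x => x \in l) Q)%:R) ->
  N / 2 <= A -> 8 / N <= be ->
  ((2 < msize f)%N -> ((msize f).-1)%:R * N ^+ 2 <= 8 * (size Q)%:R ->
     (size M)%:R <= be * (size Q)%:R) ->
  (size M)%:R <= N / 4 * ((msize f).-1)%:R + be * (size Q)%:R.
Proof.
move=> lineL N0 planar firr fmin uQ uM ML fM rich NA hbe big.
have lM l : l \in M -> is_line l by move=> /ML /lineL.
have A0 : 0 <= A by lra.
have a1 := msize_sub1_gt0 firr.
have nR : 0 <= (size Q)%:R :> R by rewrite ler0n.
have aR : 1 <= ((msize f).-1)%:R :> R by rewrite ler1n.
have h8 : 8 / N * (size Q)%:R <= be * (size Q)%:R by rewrite ler_wpM2r.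
have [[e [e0 hM he]]|case2] := component_dichotomy firr uQ uM fmin lM fM rich A0.
  (* The square a (N/2 - e)^2 >= 0 splits the Bezout bound: a e <= N a/4 + a e^2/N, and a e^2 <=
     6q. *)
  have h6 : 6 * (size Q)%:R <= N * (be * (size Q)%:R).
    have -> : 6 * (size Q)%:R = N * (6 / N * (size Q)%:R) :> R by field; rewrite gt_eqF.
    rewrite ler_wpM2l ?(ltW N0) // (le_trans _ h8) // ler_wpM2r // ler_wpM2r ?invr_ge0 ?(ltW N0) //.
    by rewrite ler_nat.
  apply: (le_trans hM); rewrite -(ler_pM2l N0).
  move: (be * _) ((msize f).-1)%:R aR h6 he {hM} => B a aR h6 he.
  have : 0 <= a * (N / 2 - e) ^+ 2 by rewrite mulr_ge0 ?sqr_ge0 // (le_trans _ aR).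
  have -> : a * (N / 2 - e) ^+ 2 = N * (N / 4 * a) - N * (a * e) + a * e ^+ 2 by field.
  rewrite mulrDr; lra.
have case2' : ((msize f).-1)%:R * N ^+ 2 <= 8 * (size Q)%:R.
  have : N ^+ 2 <= 4 * A ^+ 2 by nra.
  move: ((msize f).-1)%:R aR case2 => a aR case2; nra.
have NR : 0 <= N / 4 * ((msize f).-1)%:R by rewrite mulr_ge0 ?ler0n // divr_ge0 // ltW.
have [f2|f2] := ltnP 2 (msize f); first by rewrite (le_trans (big f2 case2')) // lerDr.
(* Planar factor: a = 1, so [case2'] reads N^2 <= 8q and the at most N lines of the plane number at
   most 8q/N. *)
have f2' : msize f = 2 by move: f2 a1; case: (msize f) => [|[|[]]].
rewrite (le_trans _ (_ : be * (size Q)%:R <= _)) ?lerDr // (le_trans _ h8) //.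
have [->|[l lM']] : M = [::] \/ exists l, l \in M.
- by case: (M) => [|l s]; [left|right; exists l; rewrite inE eqxx].
- by rewrite mulr_ge0 // divr_ge0 // ltW.
have [x xl] : exists x, l x.
  by have [_ ->] := lparamP (lM _ lM'); exists ((lparam l).1 + 0 *: (lparam l).2), 0.
have H := plane_of_deg1 f2' (vanish_point (lM _ lM') (fM _ lM') xl).
have hN : (size M)%:R <= N.
  apply: planar H uM ML _ => k kM; exact: sub_zero_set (lM _ kM) (fM _ kM).
apply: (le_trans hN); rewrite -(ler_pM2l N0).
have -> : N * (8 / N * (size Q)%:R) = 8 * (size Q)%:R by field; rewrite gt_eqF.
by move: case2'; rewrite f2' /= mul1r expr2.
Qed.

Lemma component_char0 (L : seq (set 'rV[K]_3)) (P : seq 'rV[K]_3) (N A : R)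
    f (Q : seq 'rV[K]_3) (M : seq (set 'rV[K]_3)) :
  (forall l, l \in L -> is_line l) -> 0 < N -> planar_bound L N ->
  50 * (size P)%:R < N ^+ 3 ->
  [pchar K] =i pred0 ->
  irred_elt f -> degree_minimal f Q -> (forall x, x \in Q -> f.@[x 0] = 0) ->
  uniq Q -> uniq M -> (size Q <= size P)%N -> {subset M <= L} -> (forall l, l \in M -> vanish f l) ->
  (forall l, l \in M -> A + ((msize f).-1)%:R <= (count (fun x => x \in l) Q)%:R) ->
  N / 2 <= A ->
  (size M)%:R <= N / 4 * ((msize f).-1)%:R + 16 / N * (size Q)%:R.
Proof.
move=> lineL N0 planar few char0 firr fmin fQ uQ uM QP ML fM rich NA.
apply: (component_bound lineL N0 planar firr fmin uQ uM ML fM rich NA).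
  by rewrite ler_wpM2r ?invr_ge0 ?(ltW N0) // ler_nat.
move=> f2 ha.
have lM l : l \in M -> is_line l by move=> /ML /lineL.
have qp : (size Q)%:R <= (size P)%:R :> R by rewrite ler_nat.
have q0 : 0 <= (size Q)%:R :> R by rewrite ler0n.
have a0 : 0 <= ((msize f).-1)%:R :> R by rewrite ler0n.
have aN := small_degree N0 qp few ha.
have h := flat_component char0 firr f2 uQ uM lM fM rich (small_twice N0 NA aN).
exact: flat_count N0 NA a0 q0 ha aN h.
Qed.

Lemma component_pchar p (L : seq (set 'rV[K]_3)) (P : seq 'rV[K]_3) (N A : R)
    f (Q : seq 'rV[K]_3) (M : seq (set 'rV[K]_3)) :
  (forall l, l \in L -> is_line l) -> 0 < N -> planar_bound L N ->
  50 * (size P)%:R < N ^+ 3 ->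
  p \in [pchar K] ->
  irred_elt f -> degree_minimal f Q -> (forall x, x \in Q -> f.@[x 0] = 0) ->
  uniq Q -> uniq M -> (size Q <= size P)%N -> {subset M <= L} -> (forall l, l \in M -> vanish f l) ->
  (forall l, l \in M -> A + ((msize f).-1)%:R <= (count (fun x => x \in l) Q)%:R) ->
  N / 2 <= A ->
  (size M)%:R <= N / 4 * ((msize f).-1)%:R +
    (8 / N + 16 * (size P)%:R / N ^+ 3) * (size Q)%:R.
Proof.
move=> lineL N0 planar few charp firr fmin fQ uQ uM QP ML fM rich NA.
have N3 : 0 < N ^+ 3 by rewrite exprn_gt0.
have p0 : 0 <= (size P)%:R :> R by rewrite ler0n.
apply: (component_bound lineL N0 planar firr fmin uQ uM ML fM rich NA).
  by rewrite lerDl divr_ge0 ?mulr_ge0 // ltW.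
move=> f2 ha.
have lM l : l \in M -> is_line l by move=> /ML /lineL.
(* Otherwise [frobenius_descent] gives a polynomial of smaller degree vanishing on [Q], against
   [degree_minimal]. *)
have [i hi] : exists i, f^`M(i) != 0.
  apply: contrapT => nex.
  have [i|g [g0 gf gQ]] := @frobenius_descent K p charp f Q (ltnW f2) _ fQ.
    by apply/eqP/negP => /negP hi; apply: nex; exists i.
  by have := fmin g g0 gQ; rewrite leqNgt gf.
have qp : (size Q)%:R <= (size P)%:R :> R by rewrite ler_nat.
have q0 : 0 <= (size Q)%:R :> R by rewrite ler0n.
have a0 : 0 <= ((msize f).-1)%:R :> R by rewrite ler0n.
have A0 : 0 <= A by apply: le_trans NA; rewrite divr_ge0 // ltW.
have h := smooth_component firr f2 hi uQ uM lM fM rich A0.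
exact: smooth_count N0 NA a0 q0 qp few ha h.
Qed.

End ComponentBounds.

(** * Passage to finite sets and the final contradiction *)

Lemma card_points_on (K : fieldType) (P : {fset 'rV[K]_3}) (l : set 'rV[K]_3) :
  #|` points_on P l| = count (fun x => x \in l) (enum_fset P).
Proof.
rewrite -size_filter; apply: perm_size; apply: uniq_perm.
- exact: fset_uniq.
- by rewrite filter_uniq // fset_uniq.
by move=> x; rewrite mem_filter !inE andbC.
Qed.

Lemma lines_in_leq (K : fieldType) (L : {fset set 'rV[K]_3}) (H : set 'rV[K]_3)
    (M : seq (set 'rV[K]_3)) :
  uniq M -> {subset M <= enum_fset L} -> (forall l, l \in M -> (l `<=` H)%classic) ->
  (size M <= #|` lines_in L H|)%N.
Proof.
move=> uM ML MH; apply: uniq_leq_size => // l lM; rewrite !inE /=.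
by apply/andP; split; [exact: ML|apply/asboolP/MH].
Qed.

Lemma sqr_powR (R : realType) (N : R) (k : nat) : 0 <= N ->
  (N ^+ 2) `^ (k%:R / 2) = N ^+ k.
Proof.
by move=> N0; rewrite -[N ^+ 2]powR_mulrn // -[RHS]powR_mulrn // -powRrM; congr (_ `^ _); field.
Qed.

Theorem corollary5 (R : realType) (K : fieldType) (m n : nat)
    (L : {fset set 'rV[K]_3}) (P : {fset 'rV[K]_3})
    (L_lines : forall l, l \in L -> is_line l)
    (card_L : #|` L| = m) (card_P : #|` P| = n)
    (rich : forall l, l \in L ->
       Num.sqrt (m%:R : R) <= (#|` points_on P l|)%:R)
    (planar : forall H, is_plane H ->
       (#|` lines_in L H|)%:R <= Num.sqrt (m%:R : R)) :
  ([pchar K] =i pred0 -> (n%:R : R) >= 1 / 50 * (m%:R `^ (3 / 2))) /\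
  ((exists p, p \in [pchar K]) -> (10 ^ 4 <= m)%N ->
     (n%:R : R) >= 1 / 20 * (m%:R `^ (5 / 4))).
Proof.
set N := Num.sqrt (m%:R : R) in rich planar.
have N0 : 0 <= N by apply: sqrtr_ge0.
have NE : N ^+ 2 = m%:R by rewrite sqr_sqrtr // ler0n.
have n0 : 0 <= n%:R :> R by rewrite ler0n.
have rich' l : l \in enum_fset L -> N <= (count (fun x => x \in l) (enum_fset P))%:R.
  by move=> lL; rewrite -card_points_on; apply: rich.
have planar' (H : set 'rV[K]_3) (M : seq (set 'rV[K]_3)) : is_plane H -> uniq M ->
    {subset M <= enum_fset L} -> (forall l, l \in M -> (l `<=` H)%classic) ->
    (size M)%:R <= N.
  move=> pH uM ML MH; apply: le_trans (planar H pH); rewrite ler_nat.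
  exact: lines_in_leq.
have bound (be : R) : 0 < N -> 50 * n%:R < N ^+ 3 ->
    (forall f (Q : seq 'rV[K]_3) (M : seq (set 'rV[K]_3)) (A : R),
      irred_elt f -> degree_minimal f Q -> (forall x, x \in Q -> f.@[x 0] = 0) ->
      uniq Q -> uniq M -> (size Q <= size (enum_fset P))%N -> {subset M <= enum_fset L} ->
      (forall l, l \in M -> vanish f l) ->
      (forall l, l \in M -> A + ((msize f).-1)%:R <= (count (fun x => x \in l) Q)%:R) ->
      N / 2 <= A ->
      (size M)%:R <= N / 4 * ((msize f).-1)%:R + be * (size Q)%:R) ->
    N ^+ 2 <= N ^+ 2 / 8 + be * n%:R.
  move=> Np few comp.
  have := @lines_le R K (enum_fset L) (enum_fset P) N be (fset_uniq _) (fset_uniq _)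
    L_lines rich' Np _ comp.
  by rewrite NE card_P card_L; apply.
split=> [char0|[p charp] m4]; rewrite leNgt; apply/negP => lt.
- have {}lt : 50 * n%:R < N ^+ 3.
    move: lt; have -> : m%:R `^ (3 / 2) = N ^+ 3 by rewrite -NE sqr_powR.
    lra.
  have Np : 0 < N.
    rewrite lt_neqAle N0 andbT eq_sym; apply: contraTN isT => /eqP N00.
    by move: lt; rewrite N00 expr0n /=; lra.
  have fewP : 50 * (size (enum_fset P))%:R < N ^+ 3 by rewrite card_P.
  have := bound (16 / N) Np lt (fun f Q M A =>
    @component_char0 R K _ _ N A f Q M L_lines Np planar' fewP char0).
  (* Times N, the bound reads N^3 <= N^3/8 + 16n, while 16n < (16/50) N^3. *)
  rewrite -(ler_pM2l Np).
  have -> : N * (N ^+ 2 / 8 + 16 / N * n%:R) = N ^+ 3 / 8 + 16 * n%:R.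
    by field; rewrite gt_eqF.
  have -> : N * N ^+ 2 = N ^+ 3 by ring.
  have := exprn_gt0 3 Np; lra.
have N100 : 100 <= N.
  rewrite -(@ler_pXn2r _ 2) ?nnegrE ?ler0n // NE -natrX ler_nat.
  exact: leq_trans m4.
have Np : 0 < N by lra.
have n2 : 400 * n%:R ^+ 2 < N ^+ 5.
  have e : (m%:R `^ (5 / 4)) ^+ 2 = N ^+ 5 :> R.
    by rewrite -[RHS]sqr_powR // NE -[LHS]powR_mulrn ?powR_ge0 // -powRrM; congr (_ `^ _); field.
  have : n%:R ^+ 2 < (1 / 20 * m%:R `^ (5 / 4)) ^+ 2 :> R.
    have w0 : 0 <= 1 / 20 * m%:R `^ (5 / 4) :> R.
      by rewrite mulr_ge0 ?powR_ge0 // divr_ge0.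
    by rewrite ltr_pXn2r // nnegrE.
  rewrite exprMn e; lra.
(* Squared: (50 n)^2 < (25/4) N^5, and N >= 100 turns this into N^6. This is where [m4] enters. *)
have few : 50 * n%:R < N ^+ 3.
  have h3 : 0 <= N ^+ 3 by rewrite exprn_ge0.
  rewrite -(@ltr_pXn2r _ 2) ?nnegrE ?mulr_ge0 //.
  have -> : (N ^+ 3) ^+ 2 = N * N ^+ 5 by ring.
  have : 100 * N ^+ 5 <= N * N ^+ 5 by rewrite ler_wpM2r // exprn_ge0.
  rewrite exprMn; have := exprn_ge0 5 N0; lra.
have fewP : 50 * (size (enum_fset P))%:R < N ^+ 3 by rewrite card_P.
have := bound _ Np few (fun f Q M A =>
  @component_pchar R K p _ _ N A f Q M L_lines Np planar' fewP charp).
(* Times N^3, the right side is N^5/8 + 8 N^2 n + 16 n^2, below (1/8 + 8/50 + 16/400) N^5 by [few]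
   and [n2]. *)
rewrite card_P -(ler_pM2l (exprn_gt0 3 Np)).
have -> : N ^+ 3 * (N ^+ 2 / 8 + (8 / N + 16 * n%:R / N ^+ 3) * n%:R) =
    N ^+ 5 / 8 + 8 * (N ^+ 2 * n%:R) + 16 * n%:R ^+ 2.
  by field; rewrite gt_eqF.
have -> : N ^+ 3 * N ^+ 2 = N ^+ 5 by ring.
have : N ^+ 2 * (50 * n%:R) <= N ^+ 2 * N ^+ 3 by rewrite ler_wpM2l ?exprn_ge0 // ltW.
have -> : N ^+ 2 * N ^+ 3 = N ^+ 5 by ring.
have -> : N ^+ 2 * (50 * n%:R) = 50 * (N ^+ 2 * n%:R) by ring.
have := exprn_gt0 5 Np; lra.
Qed.
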